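(* Let $P\in\mathbb{C}^{n\times n}$ be Hermitian positive definite and let $\eta\in(1,\infty]$. Then the following hold. (i) $\mathbf{L}_P(\eta)=\left\{A\in\mathbf{L}_P:\ \eta>\rho\left((A^*PA+P)(A^*P+PA)^{-1}\right)\right\}$. (ii) $A\in\mathbf{L}_P(\eta)$ implies that $\mathrm{spec}(A)\subset\mathbb{D}_{\rm inv}(\eta)$. (iii) $A\in\mathbf{L}_P(\eta)$ implies that for all $\gamma\in\left[1,\frac{\eta}{\sqrt{\eta^2-1}}\right)$ the matrix $A^\gamma$ belongs to $\mathbf{L}_P$.
   Context: For Hermitian matrices, $M\succ N$ means $M-N$ is positive definite; $\rho(M)$ is the spectral radius of a square matrix $M$. For $P\succ 0$ and $\eta\in(1,\infty]$, $$\mathbf{L}_P(\eta)=\{A\in\mathbb{C}^{n\times n}:PA+A^*P\succ\tfrac1\eta(A^*PA+P)\},$$ with $1/\infty=0$, and $\mathbf{L}_P=\mathbf{L}_P(\infty)=\{A\in\mathbb{C}^{n\times n}:PA+A^*P\succ 0\}$. For $\eta\in(1,\infty)$, $\mathbb{D}_{\rm inv}(\eta)=\{z\in\mathbb{C}:|z-\eta|<\sqrt{\eta^2-1}\}$; for $\eta=\infty$ it is understood as the limit, the open right half-plane $\{\mathrm{Re}(z)>0\}$, and $\frac{\eta}{\sqrt{\eta^2-1}}$ is read as $1$ (so that (iii) is vacuous). $A^\gamma$ denotes the principal power (every $A\in\mathbf{L}_P$ has spectrum in the open right half-plane). *)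

(* Defs.v *)
From HB Require Import structures.
From mathcomp Require Import all_boot all_order all_algebra.
From mathcomp Require Import complex.
From mathcomp Require Import all_classical all_reals all_analysis.

Set Implicit Arguments.
Unset Strict Implicit.
Unset Printing Implicit Defensive.

Import Order.TTheory GRing.Theory Num.Theory.
Import numFieldNormedType.Exports.

Local Open Scope classical_set_scope.
Local Open Scope ring_scope.
Local Open Scope complex_scope.
Local Open Scope sesquilinear_scope.

(* In the partial order of R[i], 0 < z means that z is real and positive. *)
Definition posdef (R : realType) (n : nat) (M : 'M[R[i]]_n) : Prop :=
  M \is hermsymmx /\
  forall x : 'cV[R[i]]_n, x != 0 -> 0 < (x^t* *m M *m x) ord0 ord0.

(* M ≻ N *)
Definition loewner_gt (R : realType) (n : nat) (M N : 'M[R[i]]_n) : Prop :=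
  posdef (M - N).

Definition spec (R : realType) (n : nat) (M : 'M[R[i]]_n) : set R[i] :=
  [set l | eigenvalue M l].

(* For n > 0 the spectrum is finite and nonempty, so the sup is a maximum. *)
Definition spectral_radius (R : realType) (n : nat) (M : 'M[R[i]]_n) : R :=
  sup [set Normc.normc l | l in spec M].

(* inve maps +oo to 0 *)
Definition lyap (R : realType) (n : nat) (P : 'M[R[i]]_n) (eta : \bar R) :
    set 'M[R[i]]_n :=
  [set A | loewner_gt (P *m A + A^t* *m P)
             ((fine (inve eta))%:C *: (A^t* *m P *m A + P))].

(* Only meant for 1 < eta, so the last case of the match stands for +oo;
   likewise in pow_bound. *)
Definition Dinv (R : realType) (eta : \bar R) : set R[i] :=
  match eta with
  | r%:E => [set z | Normc.normc (z - r%:C) < Num.sqrt (r ^+ 2 - 1)]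
  | _ => [set z | 0 < complex.Re z]
  end.

Definition pow_bound (R : realType) (eta : \bar R) : R :=
  match eta with
  | r%:E => r / Num.sqrt (r ^+ 2 - 1)
  | _ => 1
  end.

Definition expmx (K : numFieldType) (n : nat) (M : 'M[K]_n) : 'M[K]_n :=
  limn (series (fun k : nat => (k`!%:R)^-1 *: M ^+ k)).

(* When A has no eigenvalue in ]-oo, 0], there is exactly one such L. *)
Definition is_princ_log (R : realType) (n : nat) (A L : 'M[R[i]]_n) : Prop :=
  expmx L = A /\
  (forall l, spec L l -> - pi < complex.Im l < pi).

(* A^g = exp (g Log A).  The value where Log A does not exist is the zero
   matrix, which for n > 0 lies in no lyap P eta. *)
Definition princ_pow (R : realType) (n : nat) (A : 'M[R[i]]_n) (g : R) :
    'M[R[i]]_n :=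
  xget 0 [set expmx (g%:C *: L) | L in [set L | is_princ_log A L]].

(* Main.v *)
Require Import Defs.
From HB Require Import structures.
From mathcomp Require Import all_boot all_order all_algebra.
From mathcomp Require Import complex.
From mathcomp Require Import all_classical all_reals all_analysis.
From mathcomp Require Import ring lra.

(* Everything is measured in the norm of the inner product x^* P y.  For A in
   L_P(eta) the Cayley transform C = (A - 1)(A + 1)^-1 satisfies
   |C|^2 <= (eta - 1)/(eta + 1) < 1, so A has the logarithm L = 2 artanh C, given
   by a power series; its spectrum lies in |Im| < pi/2, and a logarithm with
   spectrum in |Im| < pi is unique.  For (iii) let C(g) be the Cayley transform of
   exp (g L): then g C' = artanh C * (1 - C^2), and the coefficients of
   artanh z * (1 - z^2) give g |C|' <= |C| + |C|^3.  Comparing Euler steps with an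
   explicit majorant keeps |C(g)| < 1 while g^2 < eta^2/(eta^2 - 1), and |C| < 1
   means that A^g is in L_P.  Part (ii) is the Rayleigh quotient of an eigenvector
   and (i) diagonalizes the pencil (A^* P A + P, A^* P + P A). *)

Set Implicit Arguments.
Unset Strict Implicit.
Unset Printing Implicit Defensive.

Import Order.TTheory GRing.Theory Num.Theory.
Import numFieldNormedType.Exports.

Local Open Scope classical_set_scope.
Local Open Scope ring_scope.
Local Open Scope complex_scope.
Local Open Scope sesquilinear_scope.

(** No derivative of a matrix function is taken. An identity such as exp (- log (1 - X)) (1 - X) = 1
    holds because a path on [0, 1] whose increments are O((t - s)^2) is constant, and the
    differential inequality for |C(g)| enters only through finite steps with an explicit quadratic
    error. Such an error needs a strict gain at every step. There is room for one: started at (eta -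
    1)/(eta + 1), the limiting equation for |C|^2 stays below 1 as long as g^2 < eta/(eta - 1),
    which exceeds eta^2/(eta^2 - 1). This gap is spent as b - a > 0 in the majorant. Uniqueness of
    the logarithm serves every step of (iii): 2 artanh C(g) has to be g L itself, not another
    logarithm of exp (g L). Once this is known at g, the spectrum of g L lies in |Im| < pi/2, so
    that of g' L lies in |Im| < pi for 0 < g' <= 2 g, which is what the next step asks for. Norm
    bound and strip are therefore propagated together. *)

Section ComplexParts.
Variable R : realType.
Implicit Types x y z : R[i].

Lemma conjCE z : Num.conj_op z = conjc z. Proof. by []. Qed.

Lemma ReD x y : complex.Re (x + y) = complex.Re x + complex.Re y.
Proof. by case: x => a b; case: y. Qed.

Lemma ReN x : complex.Re (- x) = - complex.Re x.
Proof. by case: x. Qed.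

Lemma ReB x y : complex.Re (x - y) = complex.Re x - complex.Re y.
Proof. by rewrite ReD ReN. Qed.

Lemma ReZ (a : R) x : complex.Re (a%:C * x) = a * complex.Re x.
Proof. by case: x => b c /=; rewrite mul0r subr0. Qed.

Lemma Re_conj x : complex.Re (Num.conj_op x) = complex.Re x.
Proof. by rewrite conjCE; case: x. Qed.

Lemma Re_sum (I : Type) (s : seq I) (F : I -> R[i]) :
  complex.Re (\sum_(i <- s) F i) = \sum_(i <- s) complex.Re (F i).
Proof. by apply: (big_morph _ ReD). Qed.

Lemma Im_sum (I : Type) (s : seq I) (F : I -> R[i]) :
  complex.Im (\sum_(i <- s) F i) = \sum_(i <- s) complex.Im (F i).
Proof. by apply: (big_morph _ _) => // -[a b] []. Qed.

Lemma ler_Re_normc z : complex.Re z <= Normc.normc z.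
Proof.
case: z => a b /=; apply: (le_trans (ler_norm _)).
by rewrite -sqrtr_sqr ler_wsqrtr// lerDl sqr_ge0.
Qed.

Lemma ler_norm_Im_normc z : `|complex.Im z| <= Normc.normc z.
Proof.
by case: z => a b /=; rewrite -[leLHS]sqrtr_sqr ler_wsqrtr// lerDr sqr_ge0.
Qed.

Lemma ler_norm_Re_normc z : `|complex.Re z| <= Normc.normc z.
Proof.
by case: z => a b /=; rewrite -[leLHS]sqrtr_sqr ler_wsqrtr// lerDl sqr_ge0.
Qed.

Lemma normc_ge0 z : 0 <= Normc.normc z.
Proof. by case: z => a b /=; rewrite sqrtr_ge0. Qed.

Lemma normc_sqr z :
  Normc.normc z ^+ 2 = complex.Re z ^+ 2 + complex.Im z ^+ 2.
Proof. by case: z => a b /=; rewrite sqr_sqrtr// addr_ge0// sqr_ge0. Qed.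

Lemma normcR (a : R) : Normc.normc a%:C = `|a|.
Proof. by rewrite /= expr0n addr0 sqrtr_sqr. Qed.

Lemma normc_opp z : Normc.normc (- z) = Normc.normc z.
Proof. by case: z => a b /=; rewrite !sqrrN. Qed.

Lemma normc_le_add x y : Normc.normc (x + y) <= Normc.normc x + Normc.normc y.
Proof.
by have := ler_normD x y; rewrite -rmorphD lecR.
Qed.

Lemma mul_conj_normc z : Num.conj_op z * z = (Normc.normc z ^+ 2)%:C.
Proof.
rewrite normc_sqr conjCE; case: z => a b /=; simpc; congr (_ +i* _); ring.
Qed.

End ComplexParts.

Section ConjTranspose.
Variable R : realType.

Lemma trC_mul m n p (A : 'M[R[i]]_(m, n)) (B : 'M[R[i]]_(n, p)) :
  (A *m B)^t* = B^t* *m A^t*.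
Proof. by rewrite trmx_mul map_mxM. Qed.

Lemma trC_add m n (A B : 'M[R[i]]_(m, n)) : (A + B)^t* = A^t* + B^t*.
Proof. by rewrite linearD map_mxD. Qed.

Lemma trC_opp m n (A : 'M[R[i]]_(m, n)) : (- A)^t* = - A^t*.
Proof. by rewrite linearN map_mxN. Qed.

Lemma trC_scale m n (c : R[i]) (A : 'M[R[i]]_(m, n)) :
  (c *: A)^t* = Num.conj_op c *: A^t*.
Proof. by rewrite linearZ map_mxZ. Qed.

Lemma hermsymmxP n (M : 'M[R[i]]_n) : reflect (M^t* = M) (M \is hermsymmx).
Proof.
by rewrite is_hermitianmxE expr0 scale1r eq_sym; exact: eqP.
Qed.

End ConjTranspose.

(** * Operator bounds in the norm attached to [P] *)

Section OperatorBounds.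
Variables (R : realType) (n : nat) (P : 'M[R[i]]_n.+1).
Hypothesis hP : posdef P.
Implicit Types (x y : 'cV[R[i]]_n.+1) (M N X Y : 'M[R[i]]_n.+1).

(** The real part is a real symmetric bilinear form with the same norm, and [2 * rdot x (A *m x)] is
    the quadratic form of P A + A^* P, so it suffices to express membership in L_P(eta). *)
Definition rdot x y : R := complex.Re ((x^t* *m P *m y) 0 0).
Definition vnorm x : R := Num.sqrt (rdot x x).

Lemma rdotDl x y z : rdot (x + y) z = rdot x z + rdot y z.
Proof. by rewrite /rdot trC_add !mulmxDl mxE ReD. Qed.

Lemma rdotDr x y z : rdot x (y + z) = rdot x y + rdot x z.
Proof. by rewrite /rdot mulmxDr mxE ReD. Qed.

Lemma rdotNl x y : rdot (- x) y = - rdot x y.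
Proof. by rewrite /rdot trC_opp !mulNmx mxE ReN. Qed.

Lemma rdotNr x y : rdot x (- y) = - rdot x y.
Proof. by rewrite /rdot mulmxN mxE ReN. Qed.

Lemma rdotZr (a : R) x y : rdot x (a%:C *: y) = a * rdot x y.
Proof. by rewrite /rdot -scalemxAr mxE ReZ. Qed.

Lemma rdotC x y : rdot x y = rdot y x.
Proof.
case: hP => /hermsymmxP hh _; rewrite /rdot -Re_conj.
have -> : Num.conj_op ((x^t* *m P *m y) 0 0) = ((x^t* *m P *m y)^t*) 0 0.
  by rewrite !mxE.
by rewrite !trC_mul trmxCK hh mulmxA.
Qed.

Lemma rdotZl (a : R) x y : rdot (a%:C *: x) y = a * rdot x y.
Proof. by rewrite rdotC rdotZr rdotC. Qed.

Lemma rdotZZ (c : R[i]) x y :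
  rdot (c *: x) (c *: y) = Normc.normc c ^+ 2 * rdot x y.
Proof.
rewrite /rdot trC_scale -!scalemxAl -scalemxAr mxE [X in _ * X]mxE mulrA.
by rewrite mul_conj_normc ReZ.
Qed.

Lemma rdot_gt0 x : x != 0 -> 0 < rdot x x.
Proof. by case: hP => _ h /h; rewrite ltcE /= => /andP[]. Qed.

Lemma rdot0r x : rdot x 0 = 0.
Proof. by rewrite /rdot mulmx0 mxE. Qed.

Lemma rdot_ge0 x : 0 <= rdot x x.
Proof.
have [->|/rdot_gt0/ltW//] := eqVneq x 0.
by rewrite rdot0r.
Qed.

Lemma vnorm_ge0 x : 0 <= vnorm x.
Proof. exact: sqrtr_ge0. Qed.

Lemma vnorm_sqr x : vnorm x ^+ 2 = rdot x x.
Proof. by rewrite sqr_sqrtr// rdot_ge0. Qed.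

Lemma vnorm0 : vnorm 0 = 0.
Proof. by rewrite /vnorm rdot0r sqrtr0. Qed.

Lemma vnorm_gt0 x : x != 0 -> 0 < vnorm x.
Proof. by move=> x0; rewrite sqrtr_gt0 rdot_gt0. Qed.

Lemma vnorm_eq0 x : vnorm x <= 0 -> x = 0.
Proof.
move=> h; apply/eqP/negP => /negP/vnorm_gt0.
by rewrite ltNge h.
Qed.

Lemma rdot_le x y : rdot x y <= vnorm x * vnorm y.
Proof.
have [->|x0] := eqVneq x 0; first by rewrite rdotC rdot0r vnorm0 mul0r.
have [->|y0] := eqVneq y 0; first by rewrite rdot0r vnorm0 mulr0.
have px := vnorm_gt0 x0; have py := vnorm_gt0 y0.
have := rdot_ge0 ((vnorm y)%:C *: x - (vnorm x)%:C *: y).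
rewrite rdotDl !rdotDr !rdotNl !rdotNr !rdotZl !rdotZr -(rdotC x y).
rewrite -!vnorm_sqr => h.
have pxy := mulr_gt0 px py.
rewrite -(ler_pM2l pxy); nra.
Qed.

Lemma vnormD x y : vnorm (x + y) <= vnorm x + vnorm y.
Proof.
rewrite -(ler_pXn2r (ltn0Sn 1)) ?nnegrE ?addr_ge0 ?vnorm_ge0//.
rewrite vnorm_sqr rdotDl !rdotDr (rdotC y x) -!vnorm_sqr.
have := rdot_le x y; nra.
Qed.

Lemma vnormZ (c : R[i]) x : vnorm (c *: x) = Normc.normc c * vnorm x.
Proof.
by rewrite /vnorm rdotZZ sqrtrM ?sqr_ge0// sqrtr_sqr ger0_norm// normc_ge0.
Qed.

Lemma vnormN x : vnorm (- x) = vnorm x.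
Proof. by rewrite -scaleN1r vnormZ normc_opp Normc.normc1 mul1r. Qed.

Lemma vnormB x y : vnorm x - vnorm y <= vnorm (x - y).
Proof. by rewrite lerBlDr -{1}(subrK y x) vnormD. Qed.

Lemma vnorm_sum (I : Type) (s : seq I) (F : I -> 'cV[R[i]]_n.+1) :
  vnorm (\sum_(i <- s) F i) <= \sum_(i <- s) vnorm (F i).
Proof.
elim/big_ind2: _ => //; first by rewrite vnorm0.
by move=> x a y b xa yb; apply: (le_trans (vnormD _ _)); rewrite lerD.
Qed.

(* [ob M a]: the operator norm of M induced by [vnorm] is at most a. *)
Definition ob M (a : R) := forall x, vnorm (M *m x) <= a * vnorm x.

Lemma ob_ge0 M a : ob M a -> 0 <= a.
Proof.
move=> h; have e0 : (const_mx 1 : 'cV[R[i]]_n.+1) != 0.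
  by apply/eqP => /matrixP /(_ 0 0); rewrite !mxE => /eqP; rewrite oner_eq0.
have := le_trans (vnorm_ge0 _) (h (const_mx 1)).
by rewrite pmulr_lge0// vnorm_gt0.
Qed.

Lemma ob_le M a b : a <= b -> ob M a -> ob M b.
Proof.
by move=> ab h x; apply: (le_trans (h x)); rewrite ler_wpM2r// vnorm_ge0.
Qed.

Lemma ob0 : ob 0 0.
Proof. by move=> x; rewrite mul0mx vnorm0 mul0r. Qed.

Lemma ob1 : ob 1 1.
Proof. by move=> x; rewrite mul1mx mul1r. Qed.

Lemma obD M N a b : ob M a -> ob N b -> ob (M + N) (a + b).
Proof.
move=> hM hN x; rewrite mulmxDl mulrDl.
by apply: (le_trans (vnormD _ _)); rewrite lerD.
Qed.

Lemma obN M a : ob M a -> ob (- M) a.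
Proof. by move=> h x; rewrite mulNmx vnormN. Qed.

Lemma obB M N a b : ob M a -> ob N b -> ob (M - N) (a + b).
Proof. by move=> hM hN; apply: obD => //; apply: obN. Qed.

Lemma obM M N a b : ob M a -> ob N b -> ob (M * N) (a * b).
Proof.
move=> hM hN x; rewrite -[M * N]/(M *m N) -mulmxA -mulrA.
by apply: (le_trans (hM _)); rewrite ler_wpM2l// (ob_ge0 hM).
Qed.

Lemma obZ c M a : ob M a -> ob (c *: M) (Normc.normc c * a).
Proof.
by move=> h x; rewrite -scalemxAl vnormZ -mulrA ler_wpM2l// normc_ge0.
Qed.

Lemma obZr (c : R) M a : ob M a -> ob (c%:C *: M) (`|c| * a).
Proof. by rewrite -normcR; exact: obZ. Qed.

Lemma obX M a k : ob M a -> ob (M ^+ k) (a ^+ k).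
Proof.
move=> h; elim: k => [|k IH]; first by rewrite !expr0; exact: ob1.
by rewrite !exprS; exact: obM.
Qed.

Lemma ob_scalar c : ob c%:M (Normc.normc c).
Proof. by move=> x; rewrite mul_scalar_mx vnormZ. Qed.

Lemma ob_sum (I : Type) (r : seq I) (Q : pred I) (F : I -> 'M[R[i]]_n.+1) (f : I -> R) :
  (forall i, Q i -> ob (F i) (f i)) ->
  ob (\sum_(i <- r | Q i) F i) (\sum_(i <- r | Q i) f i).
Proof.
by move=> h; elim/big_ind2: _ => //; [exact: ob0 | move=> *; exact: obD].
Qed.

Lemma ob_eq0 M : (forall e, 0 < e -> ob M e) -> M = 0.
Proof.
move=> h; apply/matrixP => i j; rewrite !mxE.
have -> : M i j = (M *m delta_mx j (0 : 'I_1)) i 0.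
  rewrite mxE (bigD1 j)//= big1 ?addr0; first by rewrite mxE !eqxx mulr1.
  by move=> k kj; rewrite mxE (negPf kj) mulr0.
rewrite (@vnorm_eq0 (M *m delta_mx j (0 : 'I_1))) ?mxE//.
apply/ler_addgt0Pr => e e0; rewrite add0r.
set x := delta_mx _ _; have px : 0 < 1 + vnorm x by rewrite ltr_pwDl ?vnorm_ge0.
apply: (le_trans (h _ (divr_gt0 e0 px) x)).
rewrite mulrAC ler_pdivrMr// ler_wpM2l//; first exact: ltW.
by rewrite lerDr.
Qed.

Lemma posdef_unitmx : P \in unitmx.
Proof.
rewrite -unitmx_tr -row_free_unit -kermx_eq0; apply/rowV0P => v /sub_kermxP hv.
apply/eqP/negP => /negP v0.
have vt0 : v^T != 0 by rewrite -(inj_eq trmx_inj) trmxK trmx0.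
have := rdot_gt0 vt0; rewrite /rdot -mulmxA -(trmxK P) -trmx_mul hv.
by rewrite trmx0 mulmx0 mxE ltxx.
Qed.

(* Dual vectors: the i-th coordinate of x is [z^* P x] for z = P^-1 e_i. *)
Lemma coord_le : exists2 c, 0 < c &
  forall x i, Normc.normc (x i 0) <= c * vnorm x.
Proof.
pose z i : 'cV[R[i]]_n.+1 := invmx P *m delta_mx i 0.
exists (1 + \sum_i vnorm (z i)).
  by rewrite ltr_pwDl// sumr_ge0// => i _; exact: vnorm_ge0.
have key x i : complex.Re (x i 0) <= (1 + \sum_i vnorm (z i)) * vnorm x.
  have -> : complex.Re (x i 0) = rdot (z i) x.
    rewrite /rdot /z trC_mul -[_ *m _ *m P]mulmxA.
    case: (hP) => /hermsymmxP hh _.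
    have -> : (invmx P)^t* *m P = 1%:M.
      by rewrite -{2}hh -trC_mul mulmxV ?posdef_unitmx// trmx1 map_mx1.
    rewrite mulmx1 mxE (bigD1 i)//= big1 ?addr0.
      by rewrite !mxE !eqxx rmorph1 mul1r.
    by move=> k ki; rewrite !mxE (negPf ki) andFb rmorph0 mul0r.
  apply: (le_trans (rdot_le _ _)); rewrite ler_wpM2r ?vnorm_ge0//.
  rewrite (bigD1 i)//= addrCA lerDl addr_ge0// sumr_ge0// => j _.
  exact: vnorm_ge0.
move=> x i; have [x0|x0] := eqVneq (x i 0) 0.
  have := key x i; by rewrite x0 Normc.normc0.
(* Rotate x so that its i-th coordinate becomes the real |x_i|. *)
pose u := Num.conj_op (x i 0) / (Normc.normc (x i 0))%:C.
have nx0 : Normc.normc (x i 0) != 0.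
  by apply/eqP => /Normc.eq0_normc /eqP; rewrite (negPf x0).
have := key (u *: x) i.
rewrite mxE /u mulrAC mul_conj_normc vnormZ Normc.normcM Normc.normcV.
rewrite normcR (ger0_norm (normc_ge0 _)).
have -> : Normc.normc (Num.conj_op (x i 0)) = Normc.normc (x i 0).
  by rewrite conjCE; case: (x i 0) => a b /=; rewrite sqrrN.
rewrite divff// mul1r; congr (_ <= _).
rewrite -(@fmorphV _ _ (real_complex R)) -rmorphM /=.
by rewrite expr2 mulfK.
Qed.

(** With [entries_ob] this is the equivalence of norms in finite dimension: [expmx] and [nlog] are
    limits in the entrywise topology, while all estimates are made with [ob]. *)
Lemma entry_le : exists2 c, 0 < c &
  forall M a, ob M a -> forall i j, Normc.normc (M i j) <= c * a.
Proof.
have [c c0 hc] := coord_le.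
exists (c * (1 + \sum_j vnorm (delta_mx j 0))).
  rewrite mulr_gt0// ltr_pwDl// sumr_ge0// => i _; exact: vnorm_ge0.
move=> M a h i j.
have -> : M i j = (M *m delta_mx j (0 : 'I_1)) i 0.
  rewrite mxE (bigD1 j)//= big1 ?addr0; first by rewrite mxE !eqxx mulr1.
  by move=> k kj; rewrite mxE (negPf kj) mulr0.
apply: (le_trans (hc _ _)); rewrite -mulrA ler_wpM2l ?(ltW c0)//.
apply: (le_trans (h _)); rewrite mulrC ler_wpM2r ?(ob_ge0 h)//.
rewrite (bigD1 j)//= addrCA lerDl addr_ge0// sumr_ge0// => k _.
exact: vnorm_ge0.
Qed.

Lemma entries_ob : exists2 c, 0 < c & forall M a, 0 <= a ->
  (forall i j, Normc.normc (M i j) <= a) -> ob M (c * a).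
Proof.
have [c c0 hc] := coord_le.
pose S := \sum_(i < n.+1) vnorm (delta_mx i 0).
have S0 : 0 <= S by apply: sumr_ge0 => i _; exact: vnorm_ge0.
exists (1 + S * (n.+1%:R * c)) => [|M a a0 h x].
  by rewrite ltr_pwDl// !mulr_ge0// ltW.
have -> : M *m x = \sum_i (M *m x) i 0 *: delta_mx i 0.
  rewrite {1}(matrix_sum_delta (M *m x)); apply: eq_bigr => i _.
  by rewrite big_ord1.
apply: (le_trans (vnorm_sum _ _)).
have le1 i : Normc.normc ((M *m x) i 0) <= n.+1%:R * c * a * vnorm x.
  rewrite mxE.
  apply: (@le_trans _ _ (\sum_(j < n.+1) Normc.normc (M i j * x j 0))).
    elim/big_ind2: _ => //; first by rewrite Normc.normc0.
    by move=> y r z s yr zs; rewrite (le_trans (normc_le_add _ _))// lerD.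
  apply: (@le_trans _ _ (\sum_(j < n.+1) (a * (c * vnorm x)))).
    apply: ler_sum => j _; rewrite Normc.normcM.
    by apply: ler_pM => //; rewrite ?normc_ge0.
  rewrite sumr_const card_ord -mulr_natl.
  by rewrite le_eqVlt; apply/orP; left; apply/eqP; ring.
apply: (@le_trans _ _ (\sum_(i < n.+1) n.+1%:R * c * a * vnorm x * vnorm (delta_mx i 0))).
  by apply: ler_sum => i _; rewrite vnormZ ler_wpM2r ?vnorm_ge0.
rewrite -mulr_sumr -/S mulrDl mul1r mulrDl.
have := mulr_ge0 a0 (vnorm_ge0 x).
set p := a * vnorm x => p0.
rewrite (_ : _ * S = S * (n.+1%:R * c) * a * vnorm x); last by ring.
by rewrite lerDr.
Qed.

Lemma ob_ex M : exists a, ob M a.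
Proof.
have [c c0 hc] := entries_ob.
exists (c * \sum_i \sum_j Normc.normc (M i j)); apply: hc.
  by do 2!apply: sumr_ge0 => ? _; exact: normc_ge0.
move=> i j; rewrite (bigD1 i)//= (bigD1 j)//= -addrA lerDl addr_ge0//.
  by apply: sumr_ge0 => ? _; exact: normc_ge0.
by do 2!apply: sumr_ge0 => ? _; exact: normc_ge0.
Qed.

End OperatorBounds.

(** * Limits of matrices and summation of series *)

Lemma lim_entries (K : numFieldType) (m : nat) (S : nat -> 'M[K]_m) (M : 'M[K]_m) :
  (forall i j e, 0 < e -> \forall k \near \oo, `|M i j - S k i j| < e) ->
  limn S = M.
Proof.
move=> h; apply: cvg_lim; first exact: norm_hausdorff.
apply/cvgrPdist_lt => e e0.
have nS : \forall k \near \oo, forall ij : 'I_m * 'I_m,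
    `|M ij.1 ij.2 - S k ij.1 ij.2| < e.
  by apply: filter_forall => -[i j]; exact: h.
apply: filterS nS => k nS.
have [nz|nz] := eqVneq (mx_norm (M - S k)) 0.
  by rewrite /Num.norm/= nz.
have [[i j]] := mx_norm_neq0 nz; rewrite /Num.norm/= => ->; rewrite !mxE/=.
exact: nS (i, j).
Qed.

Section MatrixLimits.
Variables (R : realType) (n : nat) (P : 'M[R[i]]_n.+1).
Hypothesis hP : posdef P.
Implicit Types (M N X Y : 'M[R[i]]_n.+1) (S T : nat -> 'M[R[i]]_n.+1).

(** Convergence is measured with [ob] so that bounds and commutation pass directly to the limit;
    [mcvg_norm] and [lim_entries] translate it back to [limn]. *)
Definition mcvg S M :=
  forall e : R, 0 < e -> \forall k \near \oo, ob P (S k - M) e.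

Lemma mcvg_cst M : mcvg (fun _ => M) M.
Proof.
move=> e e0; near=> k; rewrite subrr; apply: ob_le (ob0 P) => //; exact: ltW.
Unshelve. all: by end_near. Qed.

Lemma mcvgD S T M N : mcvg S M -> mcvg T N -> mcvg (fun k => S k + T k) (M + N).
Proof.
move=> hS hT e e0; have e2 : 0 < e / 2 by rewrite divr_gt0.
apply: filterS2 (hS _ e2) (hT _ e2) => k h1 h2.
rewrite opprD.
rewrite addrACA.
rewrite (splitr e).
exact: (obD hP h1 h2).
Qed.

Lemma mcvgMl X S M : mcvg S M -> mcvg (fun k => X * S k) (X * M).
Proof.
move=> hS e e0; have [a ha] := ob_ex hP X.
have a1 : 0 < a + 1 by rewrite ltr_wpDl// (ob_ge0 hP ha).
apply: filterS (hS _ (divr_gt0 e0 a1)) => k h.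
rewrite -mulrBr; apply: (ob_le (a := a * (e / (a + 1)))).
  by rewrite mulrCA ler_piMr ?(ltW e0)// ler_pdivrMr// mul1r lerDl.
exact: (obM hP ha h).
Qed.

Lemma mcvgMr X S M : mcvg S M -> mcvg (fun k => S k * X) (M * X).
Proof.
move=> hS e e0; have [a ha] := ob_ex hP X.
have a1 : 0 < a + 1 by rewrite ltr_wpDl// (ob_ge0 hP ha).
apply: filterS (hS _ (divr_gt0 e0 a1)) => k h.
rewrite -mulrBl; apply: (ob_le (a := (e / (a + 1)) * a)).
  by rewrite mulrAC -mulrA ler_piMr ?(ltW e0)// ler_pdivrMr// mul1r lerDl.
exact: (obM hP h ha).
Qed.

Lemma mcvgN S M : mcvg S M -> mcvg (fun k => - S k) (- M).
Proof.
by move=> hS e e0; apply: filterS (hS e e0) => k hk x; rewrite -opprD mulNmx vnormN.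
Qed.

Lemma mcvgB S T M N : mcvg S M -> mcvg T N -> mcvg (fun k => S k - T k) (M - N).
Proof. by move=> hS hT; exact: (mcvgD hS (mcvgN hT)). Qed.

Lemma mcvgM S T M N : mcvg S M -> mcvg T N -> mcvg (fun k => S k * T k) (M * N).
Proof.
move=> hS hT e e0; have [a ha] := ob_ex hP M; have [b hb] := ob_ex hP N.
have a0 := ob_ge0 hP ha; have b0 := ob_ge0 hP hb.
(* The product error is at most d^2 + d b + a d, and d <= 1 bounds this by d (a + b + 1) <= e. *)
pose d := Num.min 1 (e / (a + b + 1)).
have q : 0 < a + b + 1 by rewrite ltr_wpDl// addr_ge0.
have d0 : 0 < d by rewrite lt_min ltr01 divr_gt0.
apply: filterS2 (hS _ d0) (hT _ d0) => k h1 h2.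
have -> : S k * T k - M * N =
    (S k - M) * (T k - N) + ((S k - M) * N + M * (T k - N)).
  by rewrite addrA -mulrDr subrK mulrBl mulrBr addrA subrK.
apply: (ob_le (a := d * d + (d * b + a * d))).
  have d1 : d <= 1 by rewrite ge_min lexx.
  have d2 : d <= e / (a + b + 1) by rewrite ge_min lexx orbT.
  rewrite ler_pdivlMr// in d2; nra.
exact: (obD hP (obM hP h1 h2) (obD hP (obM hP h1 hb) (obM hP ha h2))).
Qed.

Lemma mcvg_eq0 M : mcvg (fun _ => 0) M -> M = 0.
Proof.
move=> h; apply/eqP; rewrite -oppr_eq0; apply/eqP; apply: (ob_eq0 hP) => e e0.
by have [k _ /(_ k (leqnn k))] := h e e0; rewrite sub0r.
Qed.

Lemma mcvg_unique S M N : mcvg S M -> mcvg S N -> M = N.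
Proof.
move=> hM hN; apply/eqP; rewrite -subr_eq0; apply/eqP/mcvg_eq0.
rewrite (_ : (fun _ => 0) = (fun k => S k - S k)); first exact: (mcvgB hM hN).
by apply/funext => k; rewrite subrr.
Qed.

Lemma mcvg_comm X S M : mcvg S M -> (forall k, GRing.comm X (S k)) ->
  GRing.comm X M.
Proof.
move=> hS c; apply: (mcvg_unique (S := fun k => X * S k)); first exact: (mcvgMl _ hS).
rewrite (_ : (fun k => X * S k) = (fun k => S k * X)); first exact: (mcvgMr _ hS).
by apply/funext => k; exact: c.
Qed.

Lemma mcvg_ob S M a : mcvg S M -> (forall k, ob P (S k) a) -> ob P M a.
Proof.
move=> hS h x; have [->|x0] := eqVneq x 0; first by rewrite mulmx0 vnorm0 mulr0.
apply/ler_addgt0Pr => e e0.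
have px := vnorm_gt0 hP x0.
have [k _ /(_ k (leqnn k)) hk] := hS _ (divr_gt0 e0 px).
have -> : M *m x = S k *m x - (S k - M) *m x by rewrite mulmxBl subKr.
apply: (le_trans (vnormD hP _ _)); rewrite vnormN; apply: lerD; first exact: h.
have := hk x; rewrite divfK//.
by rewrite gt_eqF.
Qed.

Lemma mcvg_mulv0 S M (v : 'cV[R[i]]_n.+1) : mcvg S M ->
  (forall k, S k *m v = 0) -> M *m v = 0.
Proof.
move=> hS h; have [->|v0] := eqVneq v 0; first by rewrite mulmx0.
apply: (vnorm_eq0 hP); apply/ler_addgt0Pr => e e0; rewrite add0r.
have px := vnorm_gt0 hP v0.
have [k _ /(_ k (leqnn k))/(_ v)] := hS _ (divr_gt0 e0 px).
by rewrite mulmxBl h sub0r vnormN divfK// gt_eqF.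
Qed.

Lemma mcvg_normc S M i j (e : R) : mcvg S M -> 0 < e ->
  \forall k \near \oo, Normc.normc (S k i j - M i j) < e.
Proof.
move=> hS e0; have [c c0 hc] := entry_le hP.
have e1 : 0 < e / c / 2 by rewrite !divr_gt0.
apply: filterS (hS _ e1) => k /hc /(_ i j); rewrite !mxE => /le_lt_trans; apply.
by rewrite mulrA [c * _]mulrC divfK ?gt_eqF//; lra.
Qed.

Lemma mcvg_of_entries S M :
  (forall i j, (fun k => complex.Re (S k i j)) @ \oo --> complex.Re (M i j)) ->
  (forall i j, (fun k => complex.Im (S k i j)) @ \oo --> complex.Im (M i j)) ->
  mcvg S M.
Proof.
move=> hR hI e e0; have [c c0 hc] := entries_ob hP.
have d0 : 0 < e / c / 2 by rewrite !divr_gt0.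
have nR : \forall k \near \oo, forall ij : 'I_n.+1 * 'I_n.+1,
    `|complex.Re (M ij.1 ij.2) - complex.Re (S k ij.1 ij.2)| < e / c / 2.
  by apply: filter_forall => -[i j] /=; have /cvgrPdist_lt := hR i j; apply.
have nI : \forall k \near \oo, forall ij : 'I_n.+1 * 'I_n.+1,
    `|complex.Im (M ij.1 ij.2) - complex.Im (S k ij.1 ij.2)| < e / c / 2.
  by apply: filter_forall => -[i j] /=; have /cvgrPdist_lt := hI i j; apply.
apply: filterS2 nR nI => k nR nI.
have -> : e = c * (e / c) by rewrite mulrCA divff ?mulr1// gt_eqF.
apply: hc; first by rewrite divr_ge0// ltW.
move=> i j; rewrite !mxE -normc_opp opprB.
have := nR (i, j); have := nI (i, j) => /=.
case: (M i j) => a b; case: (S k i j) => a' b' /= hb ha.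
have := normc_le_add (a - a')%:C (0 +i* (b - b'))%C.
rewrite normcR /= addr0 add0r expr0n /= add0r sqrtr_sqr.
move/le_trans; apply.
by have := ltW (ltrD ha hb); rewrite -splitr.
Qed.

Lemma mcvg_norm S M i j (e : R[i]) : mcvg S M -> 0 < e ->
  \forall k \near \oo, `|M i j - S k i j| < e.
Proof.
case: e => e e' hS h.
have [e0 ->] : 0 < e /\ e' = 0 by move: h; rewrite ltcE /= => /andP[/eqP-> ->].
apply: filterS (mcvg_normc i j hS e0) => k.
by rewrite -normc_opp opprB -ltcR.
Qed.

Lemma ob_series T (u : R ^nat) k : (forall k, ob P (T k) (u k)) ->
  ob P (series T k) (series u k).
Proof. by move=> h; rewrite !/(series _ k); exact: (ob_sum hP). Qed.

(** Completeness enters here: real and imaginary parts of each entry are dominated by a multiple of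
    [u], whose partial sums are bounded, so the limit can be assembled entry by entry. *)
Lemma mcvg_series T (u : R ^nat) B : (forall k, ob P (T k) (u k)) ->
  (forall k, series u k <= B) -> exists2 M, mcvg (series T) M & ob P M B.
Proof.
move=> h hB; have u0 k : 0 <= u k := ob_ge0 hP (h k).
have cu : cvgn (series u).
  apply: nondecreasing_is_cvgn; first exact: nondecreasing_series.
  by exists B => _ [k _ <-].
have [c c0 hc] := entry_le hP.
have ccu : cvgn (series (fun k => c * u k)).
  exact: (@is_cvg_seriesZ R u c cu).
have abs (f : R ^nat) : (forall k, `|f k| <= c * u k) -> cvgn (series f).
  move=> hf; apply: normed_cvg; apply: series_le_cvg ccu => //= k.
  by rewrite mulr_ge0// ltW.
pose M := \matrix_(i, j) ((limn (series (fun k => complex.Re (T k i j)))) +i*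
                          (limn (series (fun k => complex.Im (T k i j)))))%C
          : 'M[R[i]]_n.+1.
have hM : mcvg (series T) M.
  apply: mcvg_of_entries => i j; rewrite mxE /=.
    have : cvgn (series (fun k => complex.Re (T k i j))).
      by apply: abs => k; apply: le_trans (ler_norm_Re_normc _) (hc _ _ _ _ _).
    apply: cvg_trans; apply: near_eq_cvg; apply: nearW => k.
    by rewrite /series /= summxE Re_sum.
  have : cvgn (series (fun k => complex.Im (T k i j))).
    by apply: abs => k; apply: le_trans (ler_norm_Im_normc _) (hc _ _ _ _ _).
  apply: cvg_trans; apply: near_eq_cvg; apply: nearW => k.
  by rewrite /series /= summxE Im_sum.
exists M => //; apply: mcvg_ob hM _ => k; apply: (ob_le (hB k)) => //.
exact: ob_series.
Qed.

End MatrixLimits.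

Lemma mcvg_shift (R : realType) (n : nat) (P : 'M[R[i]]_n.+1) S M p :
  mcvg P S M -> mcvg P (fun k => S (k + p)%N) M.
Proof.
move=> h e e0; have [N _ hN] := h e e0; exists N; first by [].
move=> k Nk; exact: (hN (k + p)%N (leq_trans Nk (leq_addr _ _))).
Qed.

(** * Cauchy products and the matrix exponential *)

Lemma triangle_sum (V : nmodType) (f : nat -> nat -> V) N :
  \sum_(k < N) \sum_(i < k.+1) f (k - i)%N i =
  \sum_(j < N) \sum_(i < N | (i + j < N)%N) f i j.
Proof.
rewrite (eq_bigr (fun k : 'I_N => \sum_(i < N | (i < k.+1)%N) f (k - i)%N i)); last first.
  by move=> k _; rewrite (big_ord_widen_cond N xpredT (fun i => f (k - i)%N i)).
rewrite (exchange_big_dep xpredT)//=; apply: eq_bigr => j _.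
rewrite -(big_mkord (fun k => j < k.+1)%N (fun k => f (k - j)%N j)).
rewrite -(big_mkord (fun i => i + j < N)%N (fun i => f i j)).
rewrite (big_cat_nat (n := j))//=; last exact/ltnW/ltn_ord.
rewrite big_nat_cond big_pred0 ?add0r; last first.
  by move=> k; rewrite ltnS; case: leqP => //; rewrite ?andbF// => ->.
rewrite -{1}(add0n (j : nat)) big_addn.
rewrite (big_nat_widen _ _ N) ?leq_subr//.
apply: eq_big => [k|k _]; last by rewrite addnK.
by rewrite ltnS leq_addl ltn_subRL addnC.
Qed.

(** The square of index pairs minus the triangle i + j < N. The same formula holds for matrices and
    for real numbers, so a real remainder can dominate a matrix remainder term by term. *)
Lemma cauchy_tail (A : pzRingType) (t u w : nat -> A) N :
  (forall k, w k = \sum_(i < k.+1) t (k - i)%N * u i) ->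
  (\sum_(i < N) t i) * (\sum_(j < N) u j) - \sum_(k < N) w k =
  \sum_(j < N) \sum_(i < N | (N <= i + j)%N) t i * u j.
Proof.
move=> hw; under [X in _ - X]eq_bigr do rewrite hw.
rewrite (triangle_sum (fun i j => t i * u j)) mulr_sumr -sumrB.
apply: eq_bigr => j _; rewrite mulr_suml (bigID (fun i : 'I_N => i + j < N)%N)/=.
by rewrite addrAC subrr add0r; apply: eq_bigl => i; rewrite -leqNgt.
Qed.

Lemma exp_binomial (K : numFieldType) (A : algType K) (X Y : A) k :
  GRing.comm X Y ->
  (k`!%:R)^-1 *: (X + Y) ^+ k = \sum_(i < k.+1)
    (((k - i)`!%:R)^-1 *: X ^+ (k - i)) * ((i`!%:R)^-1 *: Y ^+ i).
Proof.
move=> c; rewrite (exprDn_comm _ c) scaler_sumr; apply: eq_bigr => i _.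
rewrite -scalerAl -scalerAr !scalerA -[_ * _ *+ _]scaler_nat scalerA; congr (_ *: _).
have ik : (i <= k)%N by rewrite -ltnS.
have f0 m : m`!%:R != 0 :> K by rewrite pnatr_eq0 -lt0n fact_gt0.
rewrite -(bin_fact ik) !natrM.
have b0 : 'C(k, i)%:R != 0 :> K by rewrite pnatr_eq0 -lt0n bin_gt0.
by field; rewrite b0 !f0.
Qed.

Lemma expR_lim (R : realType) (x : R) : expR x = limn (series (exp_coeff x)).
Proof. by []. Qed.

Lemma series_ord (V : zmodType) (u : nat -> V) k : series u k = \sum_(i < k) u i.
Proof. by rewrite seriesEord. Qed.

Section Exponential.
Variables (R : realType) (n : nat) (P : 'M[R[i]]_n.+1).
Hypothesis hP : posdef P.
Implicit Types (M X Y : 'M[R[i]]_n.+1).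

Definition exp_term X (k : nat) : 'M[R[i]]_n.+1 := (k`!%:R)^-1 *: X ^+ k.

Lemma ob_exp_term X a k : ob P X a -> ob P (exp_term X k) (exp_coeff a k).
Proof.
move=> h; have := obZr (k`!%:R)^-1 (obX hP k h).
rewrite ger0_norm ?invr_ge0// mulrC fmorphV rmorph_nat.
exact.
Qed.

Lemma exp_series_le (a : R) k : 0 <= a -> series (exp_coeff a) k <= expR a.
Proof.
move=> a0; rewrite expR_lim; apply: nondecreasing_cvgn_le; last first.
  exact: is_cvg_series_exp_coeff.
by apply: nondecreasing_series => *; exact: exp_coeff_ge0.
Qed.

Lemma expmx_cvg X : mcvg P (series (exp_term X)) (expmx X).
Proof.
have [a ha] := ob_ex hP X.
have [M hM _] := mcvg_series hP (fun k => ob_exp_term k ha)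
  (fun k => exp_series_le k (ob_ge0 hP ha)).
suff -> : expmx X = M by [].
apply: (@lim_entries R[i]) => i j e e0.
exact: (mcvg_norm hP i j hM).
Qed.

Lemma expmx_cvg_sum X :
  mcvg P (fun k => \sum_(i < k) exp_term X i) (expmx X).
Proof.
by rewrite -[X in mcvg P X _](seriesEord (exp_term X)); exact: expmx_cvg.
Qed.

Lemma exp_term_comm X Y k : GRing.comm X Y -> GRing.comm X (exp_term Y k).
Proof.
move=> c; rewrite /GRing.comm /exp_term -scalerAl -scalerAr.
by rewrite (commrX k c).
Qed.

Lemma expmx_comm X Y : GRing.comm X Y -> GRing.comm X (expmx Y).
Proof.
move=> c; apply: (mcvg_comm hP (expmx_cvg Y)) => k.
by apply: commr_sum => i _; exact: exp_term_comm.
Qed.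

Lemma exp_coeff_binomial (a b : R) k : exp_coeff (a + b) k =
  \sum_(i < k.+1) exp_coeff a (k - i)%N * exp_coeff b i.
Proof.
rewrite /exp_coeff /= mulrC.
rewrite [LHS](@exp_binomial R R^o a b k (mulrC a b)).
by apply: eq_bigr => i _; rewrite /GRing.scale/= ![_^-1 * _]mulrC.
Qed.

(** The defect of the partial sums is a sum of monomials, each bounded by the corresponding monomial
    in the norms a and b; the resulting real defect tends to exp a exp b - exp (a + b) = 0. *)
Lemma expmxD X Y : GRing.comm X Y -> expmx (X + Y) = expmx X * expmx Y.
Proof.
move=> c; have [a ha] := ob_ex hP X; have [b hb] := ob_ex hP Y.
apply/esym/eqP; rewrite -subr_eq0; apply/eqP/(mcvg_eq0 hP) => e e0.
pose D := fun k => (\sum_(i < k) exp_term X i) * (\sum_(i < k) exp_term Y i) -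
                   \sum_(i < k) exp_term (X + Y) i.
have cD : mcvg P D (expmx X * expmx Y - expmx (X + Y)).
  exact: (mcvgB hP (mcvgM hP (expmx_cvg_sum X) (expmx_cvg_sum Y)) (expmx_cvg_sum (X + Y))).
pose d := fun k => series (exp_coeff a) k * series (exp_coeff b) k -
                   series (exp_coeff (a + b)) k.
have cd : d @ \oo --> (0 : R).
  rewrite -(subrr (expR (a + b))) {1}expRD !expR_lim.
  apply: cvgB; last exact: is_cvg_series_exp_coeff.
  by apply: cvgM; exact: is_cvg_series_exp_coeff.
have hD k : ob P (D k) (d k).
  have -> : D k = \sum_(j < k) \sum_(i < k | (k <= i + j)%N) exp_term X i * exp_term Y j.
    exact: (cauchy_tail k (fun k => exp_binomial k c)).
  have -> : d k = \sum_(j < k) \sum_(i < k | (k <= i + j)%N) exp_coeff a i * exp_coeff b j.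
    rewrite /d 3!series_ord.
    exact: (cauchy_tail k (fun k => exp_coeff_binomial a b k)).
  apply: (ob_sum hP) => j _; apply: (ob_sum hP) => i _.
  exact: (obM hP (ob_exp_term _ ha) (ob_exp_term _ hb)).
have e2 : 0 < e / 2 by rewrite divr_gt0.
have /cvgrPdist_lt /(_ _ e2) nd := cd.
apply: filterS2 nd (cD _ e2) => k h1 h2.
have -> : 0 - (expmx X * expmx Y - expmx (X + Y)) =
    (D k - (expmx X * expmx Y - expmx (X + Y))) - D k.
  by rewrite addrAC subrr.
rewrite (splitr e); apply: (obB hP h2); apply: (ob_le _ (hD k)).
by rewrite sub0r normrN in h1; apply: ltW (le_lt_trans (ler_norm _) h1).
Qed.

Lemma expmx_quadratic X a : ob P X a -> a <= 1 ->
  ob P (expmx X - 1 - X) (a ^+ 2).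
Proof.
move=> ha a1; have a0 := ob_ge0 hP ha.
have cE : mcvg P (fun k => series (exp_term X) (k + 2)%N - 1 - X) (expmx X - 1 - X).
  have := mcvgB hP (mcvgB hP (mcvg_shift 2 (expmx_cvg X)) (mcvg_cst P 1)) (mcvg_cst P X).
  exact.
apply: (mcvg_ob hP cE) => k.
have -> : series (exp_term X) (k + 2)%N - 1 - X =
    \sum_(i < k) exp_term X i.+2.
  rewrite /series /= big_mkord addn2 !big_ord_recl /exp_term /=.
  by rewrite /bump !invr1 !scale1r expr0 expr1 [1 + _]addrC addrK [X + _]addrC addrK.
(* Since 2 ^ (i + 1) <= (i + 2)! and a <= 1, the terms are at most a^2 / 2 ^ (i + 1), a series with
   sum a^2. *)
have b : \sum_(i < k) exp_coeff a i.+2 <= a ^+ 2 * (1 - 2^-1 ^+ k).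
  elim: k => [|k IH]; first by rewrite big_ord0 expr0 subrr mulr0.
  rewrite big_ord_recr /=; apply: (le_trans (lerD IH (lexx _))).
  have : exp_coeff a k.+2 <= a ^+ 2 * 2^-1 ^+ k.+1.
    rewrite /exp_coeff /= -[k.+2]addn2 exprD -mulrA mulrCA.
    rewrite ler_wpM2l ?sqr_ge0//.
    apply: (@le_trans _ _ (1 * ((k + 2)`!%:R)^-1)).
      by rewrite ler_wpM2r ?invr_ge0// exprn_ile1.
    rewrite mul1r exprVn lef_pV2 ?posrE ?ltr0n ?fact_gt0 ?exprn_gt0//.
    rewrite -natrX ler_nat addn2; elim: k {IH} => // k IH.
    rewrite factS expnS leq_mul//.
  rewrite ![2^-1 ^+ k.+1]exprS; lra.
apply: (ob_le (a := \sum_(i < k) exp_coeff a i.+2)).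
  apply: (le_trans b); rewrite ler_piMr ?sqr_ge0// gerBl exprn_ge0//.
by apply: (ob_sum hP) => i _; exact: ob_exp_term.
Qed.

(** The complex exponential through real functions; in this form the sign of its real part is the
    sign of the cosine of Im z. *)
Definition cexp (z : R[i]) : R[i] :=
  (expR (complex.Re z))%:C * (cos (complex.Im z) +i* sin (complex.Im z))%C.

Lemma mcvg_scalar (f g : R ^nat) (a b : R) :
  f @ \oo --> a -> g @ \oo --> b ->
  mcvg P (fun k => (f k +i* g k)%C%:M) (a +i* b)%C%:M.
Proof.
move=> hf hg; apply: (mcvg_of_entries hP) => i j; rewrite mxE.
  have -> : (fun k => complex.Re ((f k +i* g k)%C%:M i j)) =
            (fun k => f k *+ (i == j)).
    by apply/funext => k; rewrite mxE; case: (i == j).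
  by case: (i == j); [exact: hf | exact: cvg_cst].
have -> : (fun k => complex.Im ((f k +i* g k)%C%:M i j)) =
          (fun k => g k *+ (i == j)).
  by apply/funext => k; rewrite mxE; case: (i == j).
by case: (i == j); [exact: hg | exact: cvg_cst].
Qed.

Lemma exp_term_scalar z k :
  exp_term (z%:M) k = ((k`!%:R)^-1 * z ^+ k)%:M.
Proof. by rewrite /exp_term -rmorphXn /= scale_scalar_mx. Qed.

Lemma expi k : ('i%C : R[i]) ^+ k =
  if odd k then (0 +i* (-1) ^+ k./2)%C else ((-1) ^+ k./2 +i* 0)%C.
Proof.
elim: k => [|k IH]; first by [].
rewrite exprS IH /= uphalf_half; case: (odd k); simpc => //=.
by rewrite add1n exprS mulN1r.
Qed.

Lemma expi_coeff (y : R) k : (k`!%:R)^-1 * (0 +i* y)%C ^+ k =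
  (cos_coeff y k +i* sin_coeff y k)%C.
Proof.
have -> : (0 +i* y)%C = 'i%C * y%:C by simpc.
have -> : (k`!%:R)^-1 = ((k`!%:R : R)^-1)%:C by rewrite fmorphV rmorph_nat.
rewrite exprMn expi -(rmorphXn (real_complex R)) /= /cos_coeff /sin_coeff /=.
case o : (odd k) => /=; simpc; congr (_ +i* _)%C; rewrite ?mul0r ?mul1r// -?exprnP.
  have -> : k.-1./2 = k./2; last by ring.
  by case: k o => // k /= o; rewrite uphalf_half (negPf o).
by ring.
Qed.

Lemma expmx_scalar z : expmx (z%:M : 'M[R[i]]_n.+1) = (cexp z)%:M.
Proof.
have hre (x : R) : expmx ((x +i* 0)%C%:M : 'M[R[i]]_n.+1) = (expR x)%:C%:M.
  apply: (mcvg_unique hP (expmx_cvg _)).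
  have -> : series (exp_term ((x +i* 0)%C%:M)) =
      (fun k => (series (exp_coeff x) k +i* 0)%C%:M).
    apply/funext => k; rewrite /series /=; under eq_bigr do rewrite exp_term_scalar.
    rewrite -(raddf_sum (@scalar_mx R[i] n.+1)); congr (_%:M).
    rewrite -[RHS]/(_%:C) rmorph_sum; apply: eq_bigr => j _.
    rewrite /exp_coeff /= rmorphM fmorphV rmorph_nat rmorphXn mulrC.
    by [].
  by apply: mcvg_scalar; [rewrite expR_lim; exact: is_cvg_series_exp_coeff | exact: cvg_cst].
have him (y : R) : expmx ((0 +i* y)%C%:M : 'M[R[i]]_n.+1) = (cos y +i* sin y)%C%:M.
  apply: (mcvg_unique hP (expmx_cvg _)).
  have -> : series (exp_term ((0 +i* y)%C%:M)) =
      (fun k => (series (cos_coeff y) k +i* series (sin_coeff y) k)%C%:M).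
    apply/funext => k; rewrite /series /=; under eq_bigr do rewrite exp_term_scalar expi_coeff.
    rewrite -(raddf_sum (@scalar_mx R[i] n.+1)); congr (_%:M).
    by elim/big_ind3: _ => // a b c d e f -> ->.
  apply: mcvg_scalar; rewrite unlock.
    exact: is_cvg_series_cos_coeff.
  exact: is_cvg_series_sin_coeff.
case: z => x y.
have -> : (x +i* y)%C = (x +i* 0)%C + (0 +i* y)%C by simpc.
rewrite raddfD /= expmxD ?hre ?him.
  by rewrite -rmorphM /= /cexp; simpc.
by rewrite /GRing.comm -!rmorphM mulrC.
Qed.

Lemma expmx0 : expmx (0 : 'M[R[i]]_n.+1) = 1.
Proof.
have := expmx_scalar 0; rewrite raddf0 => ->.
by rewrite /cexp /= expR0 cos0 sin0 mul1r.
Qed.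

Lemma expmxN X : expmx X * expmx (- X) = 1.
Proof. by rewrite -expmxD ?subrr ?expmx0//; exact/commrN. Qed.

(** On [v] the powers of X and of the scalar matrix [l%:M] agree, hence so do all partial sums, and
    [mcvg_mulv0] passes to the limit. *)
Lemma expmx_eigenvector X l (v : 'cV[R[i]]_n.+1) : X *m v = l *: v ->
  expmx X *m v = cexp l *: v.
Proof.
move=> h; apply/eqP; rewrite -subr_eq0 -mul_scalar_mx -expmx_scalar -mulmxBl.
apply/eqP; apply: (mcvg_mulv0 hP (mcvgB hP (expmx_cvg X) (expmx_cvg l%:M))) => k.
rewrite mulmxBl /series /= !mulmx_suml -sumrB big1// => j _.
rewrite exp_term_scalar mul_scalar_mx /exp_term -scalemxAl -scalerA.
rewrite -scalerBr; have -> : X ^+ j *m v = l ^+ j *: v; last by rewrite subrr scaler0.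
elim: j => [|j IH]; first by rewrite !expr0 mul1mx scale1r.
by rewrite !exprSr -[_ * X]/(_ *m X) -mulmxA h -scalemxAr IH scalerA mulrC.
Qed.

End Exponential.

(** * The series of - log (1 - X) and its first-order expansion *)

Section RealEstimates.
Variable R : realType.
Implicit Types (k s t : R).

Lemma geometric_le k N : 0 <= k < 1 -> \sum_(p < N) k ^+ p <= (1 - k)^-1.
Proof.
move=> /andP[k0 k1]; have q : 0 < 1 - k by rewrite subr_gt0.
rewrite -[leRHS]mul1r ler_pdivlMr//.
elim: N => [|N IH]; first by rewrite big_ord0 mul0r.
suff -> : (\sum_(p < N.+1) k ^+ p) * (1 - k) = 1 - k ^+ N.+1.
  by rewrite gerBl exprn_ge0.
elim: N.+1 => [|m IHm]; first by rewrite big_ord0 expr0; ring.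
by rewrite big_ord_recr /= mulrDl IHm exprS; ring.
Qed.

Lemma arith_geometric_le k N : 0 <= k < 1 ->
  \sum_(p < N) p.+1%:R * k ^+ p <= ((1 - k) ^+ 2)^-1.
Proof.
move=> /andP[k0 k1]; have q : 0 < (1 - k) ^+ 2 by rewrite exprn_gt0// subr_gt0.
rewrite -[leRHS]mul1r ler_pdivlMr//.
suff -> : (\sum_(p < N) p.+1%:R * k ^+ p) * (1 - k) ^+ 2 =
    1 - k ^+ N * (1 + N%:R * (1 - k)).
  rewrite gerBl mulr_ge0 ?exprn_ge0// addr_ge0// mulr_ge0//.
  by rewrite subr_ge0 ltW.
elim: N => [|m IHm]; first by rewrite big_ord0 expr0; ring.
by rewrite big_ord_recr /= mulrDl IHm [k ^+ m.+1]exprS -natr1; ring.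
Qed.

(** The remainders satisfy r_(q+1) = t r_q + (q + 1) s^q (t - s)^2, and (q + 1)^2 + (q + 1) <= (q +
    2)^2. Divided by the denominator of the logarithmic term, the constant leaves the factor p + 1
    summed in [arith_geometric_le]. *)
Lemma taylor_pow s t q : 0 <= s <= 1 -> 0 <= t <= 1 ->
  `|t ^+ q.+1 - s ^+ q.+1 - q.+1%:R * (t - s) * s ^+ q| <=
  (q.+1)%:R ^+ 2 * (t - s) ^+ 2.
Proof.
move=> /andP[s0 s1] /andP[t0 t1]; elim: q => [|q IH].
  by rewrite !expr1 expr0 mulr1 mul1r subrr normr0 mulr_ge0 ?sqr_ge0.
have -> : t ^+ q.+2 - s ^+ q.+2 - q.+2%:R * (t - s) * s ^+ q.+1 =
    t * (t ^+ q.+1 - s ^+ q.+1 - q.+1%:R * (t - s) * s ^+ q) +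
    q.+1%:R * s ^+ q * (t - s) ^+ 2.
  by rewrite !exprS -[q.+2%:R]natr1; ring.
apply: (le_trans (ler_normD _ _)).
have z : 0 <= q.+1%:R * s ^+ q * (t - s) ^+ 2.
  by rewrite mulr_ge0 ?sqr_ge0// mulr_ge0 ?exprn_ge0.
rewrite normrM (ger0_norm t0) (ger0_norm z).
apply: (@le_trans _ _ (q.+1%:R ^+ 2 * (t - s) ^+ 2 + q.+1%:R * (t - s) ^+ 2)).
  apply: lerD; first by apply: le_trans IH; rewrite ler_piMl.
  rewrite -mulrA ler_wpM2l// ler_piMl ?sqr_ge0// exprn_ile1//.
rewrite -mulrDl ler_wpM2r ?sqr_ge0// -[q.+2%:R]natr1.
have : 0 <= q.+1%:R :> R by []. nra.
Qed.

End RealEstimates.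

Lemma log_term_taylor (K : numFieldType) (A : algType K) (X : A) (s t : K) p :
  (p.+1%:R)^-1 *: (t *: X) ^+ p.+1 - (p.+1%:R)^-1 *: (s *: X) ^+ p.+1 -
    (t - s) *: X * (s *: X) ^+ p =
  ((p.+1%:R)^-1 * (t ^+ p.+1 - s ^+ p.+1 - p.+1%:R * (t - s) * s ^+ p))
    *: X ^+ p.+1.
Proof.
rewrite !exprZn -scalerAl -scalerAr -exprS !scalerA -!scalerBl; congr (_ *: _).
by field; rewrite nat1r pnatr_eq0.
Qed.

Section Logarithm.
Variables (R : realType) (n : nat) (P : 'M[R[i]]_n.+1).
Hypothesis hP : posdef P.
Implicit Types (X Y C : 'M[R[i]]_n.+1) (k s t : R).

Lemma neumann X k : ob P X k -> k < 1 ->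
  exists G, [/\ mcvg P (fun N => \sum_(p < N) X ^+ p) G,
    G * (1 - X) = 1 & ob P G (1 - k)^-1].
Proof.
move=> hX k1; have k0 := ob_ge0 hP hX.
have kk : 0 <= k < 1 by rewrite k0.
have [|G cG oG] := @mcvg_series _ _ P hP (fun p => X ^+ p) (fun p => k ^+ p)
    (1 - k)^-1 (fun p => obX hP p hX).
  by move=> N; rewrite series_ord; exact: geometric_le.
rewrite [X in mcvg P X _]seriesEord in cG.
exists G; split => //.
apply: (mcvg_unique hP (mcvgMr hP (1 - X) cG)) => e e0.
have nk : ((fun N => k ^+ N) @ \oo --> (0 : R)).
  by apply: cvg_expr; rewrite ger0_norm.
have /cvgrPdist_lt /(_ _ e0) := nk; apply: filterS => N.
rewrite sub0r normrN ger0_norm ?exprn_ge0// => /ltW h.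
suff -> : (\sum_(p < N) X ^+ p) * (1 - X) - 1 = - (X ^+ N).
  by apply: obN; apply: (ob_le h); exact: (obX hP).
elim: N {h} => [|N IH]; first by rewrite big_ord0 mul0r sub0r expr0.
rewrite big_ord_recr mulrDl addrAC IH mulrBr mulr1 -exprSr addrA addNr.
exact: sub0r.
Qed.

Definition log_term X (p : nat) : 'M[R[i]]_n.+1 := (p.+1%:R)^-1 *: X ^+ p.+1.

(* [nlog X] = - log (1 - X) when the norm of X is less than 1. *)
Definition nlog X : 'M[R[i]]_n.+1 := limn (series (log_term X : nat -> 'M[(R[i] : numFieldType)]_n.+1)).

Lemma ob_log_term X k p : ob P X k -> k < 1 -> ob P (log_term X p) (k ^+ p).
Proof.
move=> h k1; have k0 := ob_ge0 hP h.
have := obZr (p.+1%:R)^-1 (obX hP p.+1 h).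
rewrite ger0_norm ?invr_ge0// fmorphV rmorph_nat; apply: ob_le.
rewrite exprS mulrA ler_piMl ?exprn_ge0//.
by rewrite mulrC ler_pdivrMr// mul1r (le_trans (ltW k1))// ler1n.
Qed.

Lemma nlog_cvg_ob X k : ob P X k -> k < 1 ->
  mcvg P (series (log_term X)) (nlog X) /\ ob P (nlog X) (1 - k)^-1.
Proof.
move=> h k1; have k0 := ob_ge0 hP h.
have kk : 0 <= k < 1 by rewrite k0.
have [|M hM oM] := @mcvg_series _ _ P hP (log_term X) (fun p => k ^+ p)
    (1 - k)^-1 (fun p => ob_log_term p h k1).
  by move=> N; rewrite series_ord; exact: geometric_le.
suff -> : nlog X = M by [].
apply: (@lim_entries R[i]) => i j e e0; exact: (mcvg_norm hP i j hM).
Qed.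

Lemma nlog_cvg X k : ob P X k -> k < 1 ->
  mcvg P (fun N => \sum_(p < N) log_term X p) (nlog X).
Proof.
move=> h k1; rewrite -[X in mcvg P X _](seriesEord (log_term X)).
exact: (nlog_cvg_ob h k1).1.
Qed.

Lemma ob_nlog X k : ob P X k -> k < 1 -> ob P (nlog X) (1 - k)^-1.
Proof. by move=> h k1; exact: (nlog_cvg_ob h k1).2. Qed.

Lemma nlog_comm X Y k : ob P Y k -> k < 1 ->
  GRing.comm X Y -> GRing.comm X (nlog Y).
Proof.
move=> h k1 c; apply: (mcvg_comm hP (nlog_cvg h k1)) => N.
apply: commr_sum => p _; rewrite /GRing.comm /log_term -scalerAl -scalerAr.
by rewrite (commrX p.+1 c).
Qed.

Lemma nlog0 : nlog 0 = 0.
Proof.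
have h := nlog_cvg (ob0 P) ltr01.
apply: (mcvg_unique hP h).
rewrite (_ : (fun _ => _) = (fun=> 0)); first exact: mcvg_cst.
apply/funext => N; apply: big1 => p _.
by rewrite /log_term exprS mul0r scaler0.
Qed.

Lemma ob_unitZ X k s : 0 <= s <= 1 -> ob P X k -> ob P (s%:C *: X) k.
Proof.
move=> /andP[s0 s1] h; have := obZr s h; rewrite (ger0_norm s0).
apply: ob_le; exact: (ler_piMl (ob_ge0 hP h) s1).
Qed.

(* First-order expansion of t |-> nlog (t X); G is the resolvent (1 - s X)^-1. *)
Lemma nlog_taylor X k s t : ob P X k -> k < 1 -> 0 <= s <= 1 -> 0 <= t <= 1 ->
  exists G, [/\ G * (1 - s%:C *: X) = 1, ob P G (1 - k)^-1 &
    ob P (nlog (t%:C *: X) - nlog (s%:C *: X) - (t - s)%:C *: (X * G))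
      (((1 - k) ^+ 2)^-1 * (t - s) ^+ 2)].
Proof.
move=> h k1 hs ht; have k0 := ob_ge0 hP h.
have kk : 0 <= k < 1 by rewrite k0.
have obs := ob_unitZ hs h; have obt := ob_unitZ ht h.
have [G [cG G1 oG]] := neumann obs k1; exists G; split => //.
have cD := mcvgB hP (mcvgB hP (nlog_cvg obt k1) (nlog_cvg obs k1))
  (mcvgMl hP ((t - s)%:C *: X) cG).
rewrite scalerAl; apply: (mcvg_ob hP cD) => N.
rewrite -sumrB mulr_sumr -sumrB.
pose u p := p.+1%:R * k ^+ p * (t - s) ^+ 2.
apply: (ob_le (a := \sum_(p < N) u p)).
  by rewrite -mulr_suml ler_wpM2r ?sqr_ge0// arith_geometric_le.
apply: (ob_sum hP) => p _.
have -> : log_term (t%:C *: X) p - log_term (s%:C *: X) p -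
    (t - s)%:C *: X * (s%:C *: X) ^+ p =
    (p.+1%:R^-1 * (t ^+ p.+1 - s ^+ p.+1 - p.+1%:R * (t - s) * s ^+ p))%:C
      *: X ^+ p.+1.
  rewrite [(t - s)%:C]rmorphB [LHS](log_term_taylor X s%:C t%:C p).
  congr (_ *: _).
  rewrite rmorphM fmorphV !rmorphB !rmorphM !rmorphXn rmorphB rmorph_nat.
  by [].
apply: ob_le (obZr _ (obX hP p.+1 h)).
rewrite normrM ger0_norm ?invr_ge0//.
have ht2 := taylor_pow p hs ht.
rewrite /u -[_^-1 * _ * _]mulrA ler_pdivrMl//.
apply: (@le_trans _ _ (p.+1%:R ^+ 2 * (t - s) ^+ 2 * k ^+ p)); last first.
  by rewrite expr2 le_eqVlt; apply/orP; left; apply/eqP; ring.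
apply: ler_pM => //; first exact: exprn_ge0.
by rewrite exprS ler_piMl ?exprn_ge0// ltW.
Qed.

Lemma nlog_lipschitz X k s t : ob P X k -> k < 1 -> 0 <= s <= 1 -> 0 <= t <= 1 ->
  ob P (nlog (t%:C *: X) - nlog (s%:C *: X))
    ((((1 - k) ^+ 2)^-1 + (1 - k)^-1) * `|t - s|).
Proof.
move=> h k1 hs ht; have [G [_ oG oD]] := nlog_taylor h k1 hs ht.
have k0 := ob_ge0 hP h; have q : 0 < 1 - k by rewrite subr_gt0.
rewrite -(subrK ((t - s)%:C *: (X * G)) (_ - _)).
apply: ob_le (obD hP oD (obZr _ (obM hP h oG))).
rewrite mulrDl; apply: lerD.
  rewrite ler_wpM2l ?invr_ge0 ?sqr_ge0// -real_normK ?num_real// expr2.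
  rewrite ler_piMl// ler_norml; case/andP: hs => ? ?; case/andP: ht => ? ?.
  by apply/andP; split; lra.
rewrite mulrC ler_wpM2r// ler_piMl ?invr_ge0 ?ltW//.
Qed.

End Logarithm.

(** * The exponential of the logarithm *)

Lemma mcvg_sub (R : realType) (n : nat) (P : 'M[R[i]]_n.+1) S M (f : nat -> nat) :
  (forall k, (k <= f k)%N) -> mcvg P S M -> mcvg P (fun k => S (f k)) M.
Proof.
move=> hf h e e0; have [N _ hN] := h e e0; exists N; first by [].
move=> k Nk; exact: (hN (f k) (leq_trans Nk (hf k))).
Qed.

(** Replaces the vanishing of a derivative: over N equal steps the increments add up to at most K /
    N. The choice of N makes the steps shorter than d and K / N smaller than e. *)
Lemma quadratic_increments (R : realType) (n : nat) (P : 'M[R[i]]_n.+1)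
    (G : R -> 'M[R[i]]_n.+1) (K d : R) : posdef P -> 0 < d ->
  (forall s t, 0 <= s <= 1 -> 0 <= t <= 1 -> `|t - s| <= d ->
    ob P (G t - G s) (K * (t - s) ^+ 2)) ->
  G 1 = G 0.
Proof.
move=> hP d0 h; apply/eqP; rewrite -subr_eq0; apply/eqP/(ob_eq0 hP) => e e0.
pose N := (Num.trunc (Num.max d^-1 (`|K| / e))).+1.
have N0 : 0 < N%:R :> R by rewrite ltr0n.
have hN : Num.max d^-1 (`|K| / e) < N%:R.
  exact: truncnS_gt.
move: hN; rewrite gt_max => /andP[hN1 hN2].
have -> : G 1 - G 0 = \sum_(j < N) (G (j.+1%:R / N%:R) - G (j%:R / N%:R)).
  rewrite -(big_mkord xpredT (fun j => G (j.+1%:R / N%:R) - G (j%:R / N%:R))).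
  by rewrite (telescope_sumr (fun j => G (j%:R / N%:R)))// divff ?gt_eqF// mul0r.
have in01 j : (j <= N)%N -> 0 <= (j%:R / N%:R : R) <= 1.
  by move=> jN; rewrite divr_ge0//= ler_pdivrMr// mul1r ler_nat.
have df j : j.+1%:R / N%:R - j%:R / N%:R = N%:R^-1 :> R.
  by rewrite -mulrBl -natr1 addrAC subrr add0r mul1r.
apply: (ob_le (a := \sum_(j < N) (K * N%:R^-1 ^+ 2))).
  rewrite sumr_const card_ord -[_ *+ N]mulr_natl expr2 mulrCA mulVKf ?gt_eqF//.
  rewrite ler_pdivrMr//; apply: (le_trans (ler_norm _)).
  by move: hN2; rewrite ltr_pdivrMr// mulrC => /ltW.
apply: (ob_sum hP) => j _.
have := h (j%:R / N%:R) (j.+1%:R / N%:R) (in01 _ (ltnW (ltn_ord j))) (in01 _ (ltn_ord j)).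
rewrite df; apply; rewrite ger0_norm ?invr_ge0// -[leRHS]invrK.
by rewrite lef_pV2 ?posrE ?invr_gt0// ltW.
Qed.

(** To be read with S = s X, u = (t - s) X, w = (t - s) X (1 - s X)^-1 and d the exponential of the
    increment of [nlog]. Up to an invertible factor the left side is the increment of exp (nlog (t
    X)) (1 - t X); both terms on the right are quadratic in t - s because w is the first-order part
    of d - 1. *)
Lemma resolvent_increment (A : pzRingType) (d w u S : A) : w * (1 - S) = u ->
  d * (1 - (S + u)) - (1 - S) = (d - 1 - w) * (1 - (S + u)) - w * u.
Proof.
move=> hw; rewrite [in RHS]mulrBl [in RHS]mulrBl mul1r.
have -> : w * (1 - (S + u)) = u - w * u by rewrite opprD addrA mulrBr hw.
rewrite (opprB u) (addrA _ (w * u)) [_ - u - _]addrAC addrK -addrA -opprD.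
by rewrite [1 - (S + u) + u](_ : _ = 1 - S)// opprD addrA subrK.
Qed.

Lemma inverse_unique (A : pzRingType) (a b c : A) :
  a * b = 1 -> b * c = 1 -> a = c.
Proof. by move=> ab bc; rewrite -[a]mulr1 -bc mulrA ab mul1r. Qed.

Section ExpLog.
Variables (R : realType) (n : nat) (P : 'M[R[i]]_n.+1).
Hypothesis hP : posdef P.
Implicit Types (X Y C : 'M[R[i]]_n.+1) (k s t : R).

Lemma ob_expmx X a : ob P X a -> ob P (expmx X) (expR a).
Proof.
move=> ha; have [M hM oM] := mcvg_series hP (fun j => ob_exp_term hP j ha)
  (fun j => exp_series_le j (ob_ge0 hP ha)).
by rewrite (mcvg_unique hP (expmx_cvg hP X) hM).
Qed.

Lemma comm_scale c X Y : GRing.comm X Y -> GRing.comm X (c *: Y).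
Proof. by move=> h; rewrite /GRing.comm -scalerAl -scalerAr h. Qed.

Lemma nlog_comm_scale X k s t : ob P X k -> k < 1 -> 0 <= s <= 1 -> 0 <= t <= 1 ->
  GRing.comm (nlog (s%:C *: X)) (nlog (t%:C *: X)).
Proof.
move=> h k1 hs ht.
apply: (nlog_comm hP (ob_unitZ hP ht h) k1); apply: comm_scale; apply/commr_sym.
apply: (nlog_comm hP (ob_unitZ hP hs h) k1); apply: comm_scale; exact: commr_refl.
Qed.

Lemma expmx_nlog X k : ob P X k -> k < 1 -> expmx (nlog X) * (1 - X) = 1.
Proof.
move=> h k1; have k0 := ob_ge0 hP h.
pose q := (1 - k)^-1; have q1 : 1 <= q.
  by rewrite -invr1 lef_pV2 ?posrE ?subr_gt0// gerBl.
have q0 : 0 < q by apply: lt_le_trans q1.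
pose L := q ^+ 2 + q; have L0 : 0 < L by rewrite addr_gt0// exprn_gt0.
pose G t := expmx (nlog (t%:C *: X)) * (1 - t%:C *: X).
(* [expR q] bounds the exponential at s, q^2 the Taylor remainder of [nlog], L^2 that of [expmx], 2
   the factor 1 - t X, and the last q the product w u. Steps of length at most 1 / L keep the
   increment of [nlog] within norm 1, as [expmx_quadratic] requires. *)
pose K := expR q * ((q ^+ 2 + L ^+ 2) * 2 + q).
suff : G 1 = G 0.
  rewrite /G !scale1r !scale0r (nlog0 hP) (expmx0 hP) subr0 mulr1.
  by [].
have L1 : 0 < L^-1 by rewrite invr_gt0.
apply: (quadratic_increments (K := K) hP L1) => s t hs ht hd.
have [W [W1 oW oD]] := nlog_taylor hP h k1 hs ht.
have oL := nlog_lipschitz hP h k1 hs ht.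
have obs := ob_unitZ hP hs h; have obt := ob_unitZ hP ht h.
rewrite -exprVn -/q in oD; rewrite -exprVn -/q -/L in oL; rewrite -/q in oW.
set D := nlog (t%:C *: X) - nlog (s%:C *: X) in oD oL.
pose w := (t - s)%:C *: (X * W); pose u := (t - s)%:C *: X.
have hw : w * (1 - s%:C *: X) = u.
  by rewrite /w /u -scalerAl -mulrA W1 mulr1.
have tE : t%:C *: X = s%:C *: X + u.
  by rewrite -scalerDl -rmorphD /= addrC subrK.
have eE : expmx (nlog (t%:C *: X)) = expmx (nlog (s%:C *: X)) * expmx D.
  rewrite -(expmxD hP) ?[_ + D]addrC ?subrK//.
  apply: commrB; [exact: (nlog_comm_scale h)|exact: commr_refl].
have -> : G t - G s = expmx (nlog (s%:C *: X)) *
   ((expmx D - 1 - D + (D - w)) * (1 - t%:C *: X) - w * u).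
  have -> : expmx D - 1 - D + (D - w) = expmx D - 1 - w by rewrite addrA subrK.
  have key := resolvent_increment (expmx D) hw; rewrite -tE in key.
  rewrite -key.
  rewrite mulrBr.
  rewrite mulrA.
  rewrite -eE.
  reflexivity.
have oq : ob P (expmx D - 1 - D) (L ^+ 2 * (t - s) ^+ 2).
  have := expmx_quadratic hP oL; rewrite exprMn real_normK ?num_real//.
  apply; rewrite -(mulfV (lt0r_neq0 L0)) ler_wpM2l//.
  exact: ltW.
have k1' := ltW k1.
have o1 : ob P (1 - t%:C *: X) 2.
  apply: (ob_le _ (obB hP (ob1 P) obt)); lra.
have ow : ob P (w * u) (q * (t - s) ^+ 2).
  have := obM hP (obZr (t - s) (obM hP h oW)) (obZr (t - s) h).
  apply: ob_le; rewrite -real_normK ?num_real//.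
  set m := `|t - s|; have m0 : 0 <= m by exact: normr_ge0.
  have -> : m * (k * q) * (m * k) = k ^+ 2 * (q * m ^+ 2) by ring.
  by rewrite ler_piMl ?exprn_ile1// mulr_ge0 ?sqr_ge0// ltW.
apply: (ob_le _ (obM hP (ob_expmx (ob_nlog hP obs k1)) (obB hP (obM hP (obD hP oq oD) o1) ow))).
by rewrite -/q /K le_eqVlt; apply/orP; left; apply/eqP; ring.
Qed.

(* [clog C] is the logarithm of the inverse Cayley transform (1 + C) / (1 - C). *)
Definition clog C : 'M[R[i]]_n.+1 := nlog C - nlog (- C).

Lemma clog_comm C Y k : ob P C k -> k < 1 ->
  GRing.comm Y C -> GRing.comm Y (clog C).
Proof.
move=> h k1 c; apply: commrB; first exact: (nlog_comm hP h k1).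
exact: (nlog_comm hP (obN h) k1 (commrN c)).
Qed.

Lemma expmx_clog C k : ob P C k -> k < 1 -> expmx (clog C) * (1 - C) = 1 + C.
Proof.
move=> h k1; have e1 := expmx_nlog h k1.
have := expmx_nlog (obN h) k1; rewrite opprK => e2.
have c : GRing.comm (nlog C) (- nlog (- C)).
  apply: commrN; apply: (nlog_comm hP (obN h) k1); apply: commrN; apply/commr_sym.
  exact: (nlog_comm hP h k1 (commr_refl _)).
rewrite /clog (expmxD hP c).
have -> : expmx (- nlog (- C)) = 1 + C.
  have e3 := expmxN hP (- nlog (- C)); rewrite opprK in e3.
  exact: (inverse_unique e3 e2).
have cc : (1 + C) * (1 - C) = (1 - C) * (1 + C).
  by rewrite mulrBr mulrBl mulr1 mul1r mulrDr mulrDl mulr1 mul1r.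
by rewrite -mulrA cc mulrA e1 mul1r.
Qed.

End ExpLog.

(** * The series 2 artanh C, and tools for eigenvectors *)

Lemma odd_log_term (K : numFieldType) (A : algType K) (C : A) p :
  (p.+1%:R)^-1 *: C ^+ p.+1 - (p.+1%:R)^-1 *: (- C) ^+ p.+1 =
  if odd p then 0 else (2 / p.+1%:R) *: C ^+ p.+1.
Proof.
rewrite exprNn -signr_odd /=; case: (odd p) => /=.
  by rewrite expr0 mul1r subrr.
by rewrite expr1 mulN1r scalerN opprK -scalerDl -mulr2n mulr_natl.
Qed.

(** Summation by parts: c, c' are consecutive coefficients of the series V, and the boundary term c'
    C^(m+2) that 1 - C^2 pushes out is carried along, so only c' - c appears. *)
Lemma cayley_step (K : numFieldType) (A : algType K) (C V W : A) (c c' : K) m :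
  (1 - C ^+ 2) * (V + c' *: C ^+ m) - W + c' *: C ^+ (m + 2) =
  ((1 - C ^+ 2) * V - W + c *: C ^+ m) + (c' - c) *: C ^+ m.
Proof.
rewrite mulrDr [(1 - C ^+ 2) * (c' *: _)]mulrBl mul1r -scalerAr -exprD addnC.
rewrite scalerBl addrAC -[_ + _ + c' *: _]addrA subrK.
by rewrite [RHS]addrCA addrK addrA [c' *: _ + _]addrC.
Qed.

Section CayleyLog.
Variables (R : realType) (n : nat) (P : 'M[R[i]]_n.+1).
Hypothesis hP : posdef P.
Implicit Types (X Y C D L : 'M[R[i]]_n.+1) (v w : 'cV[R[i]]_n.+1).

Lemma clog_cvg C (k : R) : ob P C k -> k < 1 ->
  mcvg P (fun N => \sum_(p < N) (log_term C p - log_term (- C) p)) (clog C).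
Proof.
move=> h k1; have := mcvgB hP (nlog_cvg hP h k1) (nlog_cvg hP (obN h) k1).
rewrite (_ : (fun N => _) =
   (fun N => \sum_(p < N) (log_term C p - log_term (- C) p))) //.
by apply/funext => N; rewrite sumrB.
Qed.

Let c (N : nat) : R := 2 / (N.*2.+1)%:R.

Let cC N : (c N)%:C = 2 / (N.*2.+1)%:R.
Proof. by rewrite /c rmorphM fmorphV !rmorph_nat. Qed.

(* The telescoping coefficients 2/(2j+1) - 2/(2j+3) are positive and sum to 2. *)
Lemma clog_bound C (k : R) : ob P C k -> k < 1 ->
  ob P ((1 - C ^+ 2) * clog C - C *+ 2) (2 * k ^+ 3).
Proof.
move=> h k1; have k0 := ob_ge0 hP h; have k1' := ltW k1.
have c0 N : 0 <= c N by rewrite divr_ge0.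
pose V N := \sum_(p < N) (log_term C p - log_term (- C) p).
have cV : mcvg P (fun N => (1 - C ^+ 2) * V N.*2.+1 - C *+ 2)
    ((1 - C ^+ 2) * clog C - C *+ 2).
  have hf N : (N <= N.*2.+1)%N by rewrite -addnn -addnS leq_addr.
  exact: (mcvgB hP (mcvgMl hP _ (mcvg_sub hf (clog_cvg h k1))) (mcvg_cst P _)).
apply: (mcvg_ob hP cV) => N.
have kX m : (3 <= m)%N -> ob P (C ^+ m) (k ^+ 3).
  by move=> m3; apply: (ob_le _ (obX hP m h)); rewrite ler_wiXn2l.
have VS q : V q.+1 = V q + (log_term C q - log_term (- C) q).
  by rewrite /V big_ord_recr.
have Vstep m : V m.+1.*2.+1 = V m.*2.+1 + (c m.+1)%:C *: C ^+ m.+1.*2.+1.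
  rewrite doubleS VS [V m.*2.+2]VS -addrA; congr (_ + _).
  (* Term p carries the power p + 1, so of the two new terms the one with odd p is an even power and
     cancels. *)
  rewrite /log_term !odd_log_term /= odd_double /= add0r cC.
  by rewrite doubleS.
(* With the boundary term included, the bound telescopes to 2 - c m; removing that term at the end
   costs c N, for a total of 2 at every N. *)
have hZ m : ob P ((1 - C ^+ 2) * V m.*2.+1 - C *+ 2 + (c m)%:C *: C ^+ m.+1.*2.+1)
    ((2 - c m) * k ^+ 3).
  elim: m => [|m IH].
    have -> : (1 - C ^+ 2) * V 1%N - C *+ 2 + (c 0)%:C *: C ^+ 3 = 0.
      rewrite /V big_ord1 /log_term odd_log_term /= cC expr1.
      rewrite divr1 -scalerAr mulrBl mul1r -exprSr scalerBr.
      rewrite (scaler_nat 2 C).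
      by rewrite [C *+ 2 - _ - _]addrAC subrr sub0r addNr.
    by rewrite /c divr1 subrr mul0r; exact: ob0.
  rewrite Vstep (_ : m.+2.*2.+1 = (m.+1.*2.+1 + 2)%N); last by rewrite doubleS addn2.
  rewrite [X in ob _ X _](cayley_step C _ _ (c m)%:C).
  rewrite -rmorphB /=.
  have := obD hP IH (obZr (c m.+1 - c m) (kX m.+1.*2.+1 isT)).
  apply: ob_le; rewrite -mulrDl ler_wpM2r ?exprn_ge0// ler0_norm.
    by lra.
  rewrite subr_le0 /c ler_wpM2l// lef_pV2 ?posrE// ler_nat.
  by rewrite doubleS; do 2 apply: leqW.
rewrite -(addrK ((c N)%:C *: C ^+ N.+1.*2.+1) (_ - _)).
apply: (ob_le _ (obB hP (hZ N) (obZr (c N) (kX N.+1.*2.+1 isT)))).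
by rewrite ger0_norm// -mulrDl subrK.
Qed.

(** Lets [clog] of a scalar matrix be read as a number: it commutes with everything its argument
    commutes with. *)
Lemma scalar_of_comm X : (forall Y, GRing.comm Y X) -> X = (X 0 0)%:M.
Proof.
move=> h; apply/matrixP => i j; rewrite mxE.
have /matrixP /(_ 0 j) := h (delta_mx 0 i).
rewrite -[_ * X]/(_ *m X) -[X * _]/(X *m _) mxE (bigD1 i)//= big1; last first.
  by move=> k /negPf ki; rewrite mxE ki andbF mul0r.
rewrite !mxE !eqxx mul1r addr0 => ->.
rewrite (bigD1 0)//= big1; last by move=> k /negPf k0; rewrite !mxE k0 mulr0.
by rewrite !mxE eqxx addr0 eq_sym; case: (i == j); rewrite ?mulr1 ?mulr0.
Qed.

(** By Cayley-Hamilton the product of the X - z over the roots kills v; B is the last partial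
    product that does not. Being a polynomial in X, it commutes with every Y that commutes with X,
    so an eigenvector of Y is moved to a common eigenvector of X and Y. *)
Lemma eigen_refine X v : v != 0 ->
  exists w a B, [/\ w != 0, X *m w = a *: w, w = B *m v &
    forall Y, GRing.comm Y X -> GRing.comm Y B].
Proof.
have [s hs] := closed_field_poly_normal (char_poly X).
rewrite (monicP (char_poly_monic X)) scale1r in hs.
have : (\prod_(z <- s) (X - z%:M)) *m v = 0.
  have := Cayley_Hamilton X; rewrite hs rmorph_prod /=.
  under eq_bigr do rewrite rmorphB /= horner_mx_X horner_mx_C.
  by move=> ->; rewrite mul0mx.
elim: s {hs} => [|a s IH]; first by rewrite big_nil mul1mx => ->; rewrite eqxx.
rewrite big_cons -[_ * _]/(_ *m _) -mulmxA => h v0.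
have [/IH|u0] := eqVneq ((\prod_(z <- s) (X - z%:M)) *m v) 0; first exact.
exists ((\prod_(z <- s) (X - z%:M)) *m v), a, (\prod_(z <- s) (X - z%:M)).
split => //.
  by move/eqP: h; rewrite mulmxBl mul_scalar_mx subr_eq0 => /eqP.
move=> Y cY; apply: commr_prod => z _; apply: commrB => //.
by rewrite /GRing.comm -[Y * _]/(Y *m _) scalar_mxC.
Qed.

(** [eigenvalue] speaks of row vectors acting from the left, whereas the norm is on column
    vectors. *)
Lemma eigenvalue_colP X (l : R[i]) :
  eigenvalue X l <-> exists2 v : 'cV[R[i]]_n.+1, v != 0 & X *m v = l *: v.
Proof.
split=> [/eigenvalueP [u hu u0]|[v v0 hv]].
  have : X^T - l%:M \notin unitmx.
    rewrite -unitmx_tr linearB /= trmxK tr_scalar_mx; apply/negP => U.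
    have : u *m (X - l%:M) = 0 by rewrite mulmxBr hu mul_mx_scalar subrr.
    by move/(congr1 (mulmx^~ (invmx (X - l%:M)))); rewrite mulmxK// mul0mx => /eqP; apply/negP.
  rewrite -row_free_unit -kermx_eq0 => /rowV0Pn [w /sub_kermxP hw w0].
  exists w^T; first by rewrite -(inj_eq trmx_inj) trmxK trmx0.
  apply: trmx_inj; rewrite trmx_mul trmxK linearZ /= trmxK.
  by apply/eqP; rewrite -subr_eq0 -mul_mx_scalar -mulmxBr hw.
rewrite /eigenvalue /eigenspace kermx_eq0 row_free_unit; apply/negP => U.
have : (X - l%:M) *m v = 0 by rewrite mulmxBl hv mul_scalar_mx subrr.
by move/(congr1 (mulmx (invmx (X - l%:M)))); rewrite mulKmx// mulmx0 => /eqP; apply/negP.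
Qed.

End CayleyLog.

(** * The spectrum of 2 artanh C lies in |Im| < pi/2 *)

Lemma subrBB (V : zmodType) (a b c d : V) : a - b - (c - d) = a - c - (b - d).
Proof. by rewrite !opprB addrACA [RHS]addrACA [- b + _]addrC. Qed.

Lemma sub_entry (V : zmodType) m p (A B : 'M[V]_(m, p)) i j :
  (A - B) i j = A i j - B i j.
Proof. by rewrite !mxE. Qed.

Lemma ImB (R : rcfType) (x y : R[i]) :
  complex.Im (x - y) = complex.Im x - complex.Im y.
Proof. by case: x; case: y. Qed.

Lemma eq_sum_mulmx (K : fieldType) m (A B : nat -> 'M[K]_m.+1)
    (v : 'cV[K]_m.+1) N : (forall p, A p *m v = B p *m v) ->
  (\sum_(p < N) A p - \sum_(p < N) B p) *m v = 0.
Proof.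
move=> h; rewrite mulmxBl !mulmx_suml -sumrB big1// => p _.
by rewrite h subrr.
Qed.

Lemma odd_power_eigen (K : fieldType) m (C : 'M[K]_m.+1) (a c : K)
    (v : 'cV[K]_m.+1) p : C *m v = a *: v ->
  (c *: C ^+ p - c *: (- C) ^+ p) *m v =
  (c *: a%:M ^+ p - c *: (- a%:M) ^+ p) *m v.
Proof.
have pw (B D : 'M[K]_m.+1) : B *m v = D *m v -> GRing.comm B D ->
    B ^+ p *m v = D ^+ p *m v.
  move=> hB cBD; elim: p => [|q IH]; first by rewrite !expr0.
  rewrite exprSr exprS -[_ * B]/(_ *m B) -[D * _]/(D *m _) -!mulmxA hB -IH !mulmxA.
  by congr (_ *m v); rewrite -[LHS]/(_ * _) -[RHS]/(_ * _); apply/esym/commrX/commr_sym.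
move=> hC; have hC' : C *m v = a%:M *m v by rewrite hC mul_scalar_mx.
have cC : GRing.comm C a%:M by rewrite /GRing.comm -[C * _]/(C *m _) scalar_mxC.
rewrite !mulmxBl -!scalemxAl (pw _ _ hC' cC); congr (_ - c *: _).
apply: pw; first by rewrite !mulNmx hC'.
by apply/commrN/commr_sym/commrN/commr_sym.
Qed.

Section Strip.
Variables (R : realType) (n : nat) (P : 'M[R[i]]_n.+1).
Hypothesis hP : posdef P.
Implicit Types (X Y C D L : 'M[R[i]]_n.+1) (v w : 'cV[R[i]]_n.+1).

(** Multiplying (1 + w)/(1 - w) by |1 - w|^2 gives the real part 1 - |w|^2. *)
Lemma cayley_Re_gt0 (e w : R[i]) : Normc.normc w < 1 ->
  e * (1 - w) = 1 + w -> 0 < complex.Re e.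
Proof.
case: e w => a b [x y] hw.
have {hw} : x ^+ 2 + y ^+ 2 < 1.
  have := normc_sqr (x +i* y)%C => /= <-.
  by rewrite expr_lt1// normc_ge0.
move=> hw; simpc => -[e1 e2] /=.
have e3 : a * ((1 - x) ^+ 2 + y ^+ 2) = 1 - (x ^+ 2 + y ^+ 2).
  have -> : a * ((1 - x) ^+ 2 + y ^+ 2) =
    (1 - x) * (a * (1 - x) + b * y) - y * (b * (1 - x) - a * y) by ring.
  rewrite e1.
  have -> : b * (1 - x) - a * y = y by rewrite addrC.
  by ring.
have : 0 < a * ((1 - x) ^+ 2 + y ^+ 2) by rewrite e3 subr_gt0.
by rewrite pmulr_lgt0// lt0r; have := sqr_ge0 (1 - x); have := sqr_ge0 y; nra.
Qed.

Lemma Re_cexp_gt0 (z : R[i]) : 0 < complex.Re (cexp z) -> 0 < cos (complex.Im z).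
Proof. by rewrite /cexp ReZ pmulr_rgt0// expR_gt0. Qed.

(** The width 2 pi is that of a difference of two numbers with |Im| < pi. From cos y = 1 follows sin
    (y/2) = 0, and |y/2| < pi leaves only y = 0. *)
Lemma cexp_eq1 (z : R[i]) : `|complex.Im z| < 2 * pi -> cexp z = 1 -> z = 0.
Proof.
case: z => x y /= hy; rewrite /cexp /=; simpc => -[h1 h2].
have e0 := expR_gt0 x.
have s0 : sin y = 0 by move/eqP: h2; rewrite mulf_eq0 gt_eqF//= => /eqP.
have c1 : cos y = 1.
  have := cos2Dsin2 y; rewrite s0 expr0n addr0 => /eqP.
  rewrite -subr_eq0 subr_sqr_1 mulf_eq0 => /orP[|/eqP h].
    by rewrite subr_eq0 => /eqP.
  have hc : cos y = -1 by lra.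
  by move: h1; rewrite hc; lra.
have x0 : x = 0.
  by move: h1; rewrite c1 mulr1 => /eqP; rewrite -expR0 => /eqP /expR_inj.
have y0 : y = 0.
  have h2' : cos (y / 2) ^+ 2 = 1.
    have := cos2Dsin2 (y / 2).
    have : cos (y / 2 *+ 2) = 1 by rewrite -mulr_natr divfK.
    rewrite cos_mulr2n; lra.
  apply/eqP/negPn/negP => yn0.
  have hs : sin (y / 2) = 0.
    have hs2 : sin (y / 2) ^+ 2 = 0 by have := cos2Dsin2 (y / 2); rewrite h2'; lra.
    by move/eqP: hs2; rewrite sqrf_eq0 => /eqP.
  case: (ltgtP y 0) yn0 => // yy _.
    have : 0 < sin (- (y / 2)).
      by apply: sin_gt0_pi; move: hy; rewrite ltr_norml => /andP[? ?]; apply/andP; split; lra.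
    by rewrite sinN hs oppr0 ltxx.
  have : 0 < sin (y / 2).
    by apply: sin_gt0_pi; move: hy; rewrite ltr_norml => /andP[? ?]; apply/andP; split; lra.
  by rewrite hs ltxx.
by rewrite x0 y0.
Qed.

(* Applied to the imaginary part of t |-> clog (t c), which starts at 0 and can
   never cross +-pi/2. *)
Lemma lipschitz_cos_lt (f : R -> R) (K : R) : 0 <= K -> f 0 = 0 ->
  (forall s t, 0 <= s <= 1 -> 0 <= t <= 1 -> `|f t - f s| <= K * `|t - s|) ->
  (forall t, 0 <= t <= 1 -> 0 < cos (f t)) -> `|f 1| < pi / 2.
Proof.
move=> K0 f0 hL hcos; rewrite ltNge; apply/negP => hf.
(* Clamping the argument to [0, 1] makes the function continuous on the whole line before the
   intermediate value theorem is applied. *)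
pose cl (t : R) := if t < 0 then 0 else if 1 < t then 1 else t.
have cl01 t : 0 <= cl t <= 1.
  by rewrite /cl; case: ltP => ?; [|case: ltP => ?]; apply/andP; split; lra.
have clL s t : `|cl t - cl s| <= `|t - s|.
  have h1 := ler_norm (t - s); have h2 : - (t - s) <= `|t - s| by rewrite -normrN ler_norm.
  rewrite /cl ler_norml; case: (ltP t 0) => ?; case: (ltP s 0) => ?;
  case: (ltP 1 t) => ?; case: (ltP 1 s) => ?; apply/andP; split; lra.
pose g t := f (cl t).
have gc : continuous g.
  move=> t; apply/cvgrPdist_lt => e e0.
  have K1 : 0 < K + 1 by rewrite ltr_wpDl.
  have := @nbhsx_ballx _ _ t (e / (K + 1)) (divr_gt0 e0 K1).
  apply: filterS => s; rewrite /ball /= ltr_pdivlMr// => hs.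
  apply: le_lt_trans hs; apply: (le_trans (hL _ _ (cl01 _) (cl01 _))).
  rewrite mulrC mulrDr mulr1; have := clL s t; have := normr_ge0 (t - s).
  nra.
have g1 : g 1 = f 1 by rewrite /g /cl ltxx ltr10.
have g0 : g 0 = 0 by rewrite /g /cl ltxx ltr10.
have p0 : 0 < pi / 2 :> R by rewrite divr_gt0// pi_gt0.
have contra u : `|u| = pi / 2 -> Num.min (g 0) (g 1) <= u <= Num.max (g 0) (g 1) -> False.
  move=> hu huv.
  have [|t ht gt] := IVT ler01 _ huv; first exact: continuous_subspaceT.
  have := hcos _ (cl01 t); rewrite -/(g t) gt.
  case: (ger0P u) hu => _ hu; first by rewrite hu cos_pihalf ltxx.
  by rewrite -cosN hu cos_pihalf ltxx.
rewrite g1 g0 in contra.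
case: (ger0P (f 1)) hf => h1 hf.
  apply: (contra (pi / 2)); first by rewrite ger0_norm// ltW.
  by rewrite ge_min le_max hf (ltW p0) orbT.
apply: (contra (- (pi / 2))); first by rewrite normrN ger0_norm// ltW.
by rewrite ge_min le_max [f 1 <= - _]lerNr hf orbT/= oppr_le0 (ltW p0).
Qed.

(** On v the matrix C acts as the number a, so l is the value of [clog] at the scalar matrix a.
    Along t a the exponential is (1 + t a)/(1 - t a), whose real part is positive, hence the cosine
    of the imaginary part never vanishes. *)
Lemma clog_eigen C (k : R) v (a l : R[i]) : ob P C k -> k < 1 -> v != 0 ->
  C *m v = a *: v -> clog C *m v = l *: v -> `|complex.Im l| < pi / 2.
Proof.
move=> h k1 v0 hC hl; have k0 := ob_ge0 hP h.
have ak : Normc.normc a <= k.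
  by have := h v; rewrite hC vnormZ ler_pM2r// vnorm_gt0.
have oa : ob P (a%:M) k by apply: ob_le ak (ob_scalar P a).
pose F (t : R) := clog (t%:C *: (a%:M : 'M[R[i]]_n.+1)).
pose f t := complex.Im (F t 0 0).
have FE t : 0 <= t <= 1 -> F t = (F t 0 0)%:M.
  move=> ht; apply: scalar_of_comm => Y.
  apply: (clog_comm hP (ob_unitZ hP ht oa) k1); apply: comm_scale.
  by rewrite /GRing.comm -[Y * _]/(Y *m _) scalar_mxC.
have in1 : 0 <= (1 : R) <= 1 by rewrite ler01 lexx.
have in0 : 0 <= (0 : R) <= 1 by rewrite ler01 lexx.
have -> : l = F 1 0 0.
  have e1 : clog C *m v = clog (a%:M) *m v.
    apply/eqP; rewrite -subr_eq0 -mulmxBl; apply/eqP.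
    apply: (mcvg_mulv0 hP (mcvgB hP (clog_cvg hP h k1) (clog_cvg hP oa k1))) => N.
    apply: (@eq_sum_mulmx R[i] n (fun p => log_term C p - log_term (- C) p)
      (fun p => log_term a%:M p - log_term (- a%:M) p) v N) => p.
    exact: (odd_power_eigen _ _ hC).
  have F1 : F 1 *m v = F 1 0 0 *: v by rewrite {1}(FE _ in1) mul_scalar_mx.
  move: hl; rewrite e1 -[a%:M]scale1r -/(F 1) F1 => /eqP.
  rewrite -subr_eq0 -scalerBl scaler_eq0 (negPf v0) orbF subr_eq0 => /eqP <-.
  by [].
have [c c0 hc] := entry_le hP.
pose K1 := ((1 - k) ^+ 2)^-1 + (1 - k)^-1.
have K10 : 0 <= K1.
  by apply: addr_ge0; rewrite invr_ge0; [exact: sqr_ge0 | rewrite subr_ge0 ltW].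
rewrite -/(f 1).
apply: (lipschitz_cos_lt (f := f) (K := c * (K1 + K1))).
- exact: (mulr_ge0 (ltW c0) (addr_ge0 K10 K10)).
- by rewrite /f /F scale0r /clog oppr0 subrr mxE.
- move=> s t hs ht.
  have o1 := nlog_lipschitz hP oa k1 hs ht.
  have o2 := nlog_lipschitz hP (obN oa) k1 hs ht.
  have := obB hP o1 o2.
  have -> : nlog (t%:C *: a%:M) - nlog (s%:C *: a%:M) -
    (nlog (t%:C *: - a%:M) - nlog (s%:C *: - a%:M)) = F t - F s.
    have fE u : F u = nlog (u%:C *: a%:M) - nlog (u%:C *: - a%:M).
      by rewrite /F /clog scalerN.
    by rewrite (fE s) (fE t); exact: subrBB.
  move=> /hc /(_ 0 0); rewrite -/K1 -mulrDl mulrA.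
  apply: le_trans; apply: le_trans (ler_norm_Im_normc _).
  by rewrite (sub_entry (F t) (F s)) ImB.
- move=> t ht; apply: Re_cexp_gt0.
  have := expmx_clog hP (ob_unitZ hP ht oa) k1.
  rewrite -/(F t) (FE _ ht) (expmx_scalar hP) scale_scalar_mx.
  rewrite -[1](_ : 1%:M = 1)// -raddfB -rmorphM -raddfD => /matrixP /(_ 0 0).
  rewrite !mxE eqxx /= !mulr1n; apply: cayley_Re_gt0.
  rewrite Normc.normcM normcR; case/andP: ht => t0 t1.
  rewrite ger0_norm//; apply: le_lt_trans k1; apply: le_trans ak.
  by rewrite ler_piMl// normc_ge0.
Qed.

End Strip.

(** * Uniqueness of the logarithm with spectrum in |Im| < pi *)

Lemma comm_eigenvector (K : fieldType) m (Y B : 'M[K]_m.+1) (v : 'cV[K]_m.+1) l :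
  GRing.comm Y B -> Y *m v = l *: v -> Y *m (B *m v) = l *: (B *m v).
Proof.
move=> c h; rewrite mulmxA -[Y *m B]/(Y * B) c -[B * Y]/(B *m Y) -mulmxA h.
by rewrite scalemxAr.
Qed.

Lemma sum_two_terms (K : fieldType) m (F : nat -> 'M[K]_m.+1) (D : 'M[K]_m.+1)
    (z : 'cV[K]_m.+1) k : F 0%N = 1 -> F 1%N = D ->
  (forall i, F i.+2 *m z = 0) ->
  (\sum_(i < k.+2) F i - (1 + D)) *m z = 0.
Proof.
move=> F0 F1 h; rewrite !big_ord_recl /= F0 F1.
rewrite (addrA 1) [_ - (1 + D)]addrAC subrr add0r.
by rewrite mulmx_suml big1.
Qed.

Lemma pow_annihilates (K : fieldType) m (D : 'M[K]_m.+1) (z : 'cV[K]_m.+1) c i :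
  D *m (D *m z) = 0 -> (c *: D ^+ i.+2) *m z = 0.
Proof.
move=> h; rewrite -addn2 exprD -[_ * _]/(_ *m _) -scalemxAl -mulmxA.
by rewrite expr2 -[D * D]/(D *m D) -[D *m D *m z]mulmxA h mulmx0 scaler0.
Qed.

Lemma mulmx_neq0 (K : fieldType) m (D : 'M[K]_m.+1) : D != 0 ->
  exists v : 'cV[K]_m.+1, D *m v != 0.
Proof.
move=> /matrix0Pn [i [j Dij]]; exists (delta_mx j 0).
apply/eqP => /matrixP /(_ i 0); rewrite !mxE (bigD1 j)//= big1.
  by rewrite mxE !eqxx mulr1 addr0 => /eqP; apply/negP.
by move=> k kj; rewrite mxE (negPf kj) mulr0.
Qed.

Section LogUnique.
Variables (R : realType) (n : nat) (P : 'M[R[i]]_n.+1).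
Hypothesis hP : posdef P.
Implicit Types (X Y C D L : 'M[R[i]]_n.+1) (v w : 'cV[R[i]]_n.+1).

(** Excludes Jordan blocks below: if exp D = 1 and D^2 v = 0, then D v = 0. *)
Lemma expmx_square_zero D v : D *m (D *m v) = 0 -> expmx D *m v = v + D *m v.
Proof.
move=> h; have e : (expmx D - (1 + D)) *m v = 0.
  apply: (mcvg_mulv0 hP (mcvgB hP (mcvg_shift 2 (expmx_cvg_sum hP D)) (mcvg_cst P (1 + D)))).
  move=> k; have e1 : exp_term D 1 = D by rewrite /exp_term invr1 scale1r.
  have e0 : exp_term D 0 = 1 by rewrite /exp_term invr1 scale1r.
  have := sum_two_terms k e0 e1 (fun i => pow_annihilates _ i h).
  by rewrite addn2.
move: e; rewrite mulmxBl => /eqP; rewrite subr_eq0 => /eqP ->.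
by rewrite mulmxDl mul1mx.
Qed.

Lemma expmx_inj_strip L M : GRing.comm L M -> expmx L = expmx M ->
  (forall l v, v != 0 -> L *m v = l *: v -> `|complex.Im l| < pi) ->
  (forall l v, v != 0 -> M *m v = l *: v -> `|complex.Im l| < pi) ->
  L = M.
Proof.
move=> c e hL hM; pose D := L - M.
have cLD : GRing.comm L D by apply: commrB; [exact: commr_refl | exact: c].
have cMD : GRing.comm M D.
  by apply: commrB; [exact: (commr_sym c) | exact: commr_refl].
have eD : expmx D = 1.
  by rewrite /D (expmxD hP (commrN c)) e; exact: (expmxN hP).
(* Refining first along L and then along M gives a common eigenvector of D, L and M, so d is a
   difference of eigenvalues of L and M and [cexp_eq1] applies. *)
have D0 d v : v != 0 -> D *m v = d *: v -> d = 0.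
  move=> v0 hv.
  have [w [a [B [w0 hw wE cB]]]] := eigen_refine L v0.
  have Dw : D *m w = d *: w.
    by rewrite wE; apply: comm_eigenvector hv; apply: cB; exact: (commr_sym cLD).
  have [u [b [B' [u0 hu uE cB']]]] := eigen_refine M w0.
  have Du : D *m u = d *: u.
    by rewrite uE; apply: comm_eigenvector Dw; apply: cB'; exact: (commr_sym cMD).
  have Lu : L *m u = a *: u.
    by rewrite uE; apply: comm_eigenvector hw; apply: cB'; exact: c.
  have dab : d = a - b.
    have := Du; rewrite /D mulmxBl Lu hu -scalerBl => /eqP.
    by rewrite -subr_eq0 -scalerBl scaler_eq0 (negPf u0) orbF subr_eq0 => /eqP <-.
  apply: cexp_eq1.
    rewrite dab ImB; apply: (le_lt_trans (ler_normB _ _)).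
    by have := hL _ _ u0 Lu; have := hM _ _ u0 hu; lra.
  have := expmx_eigenvector hP Du; rewrite eD mul1mx => /eqP.
  rewrite -[X in X == _]scale1r -subr_eq0 -scalerBl scaler_eq0 (negPf u0) orbF.
  by rewrite subr_eq0 => /eqP <-.
apply/eqP; rewrite -subr_eq0 -/D; apply/negPn/negP => Dn0.
(* The refinement starts from D v, not from v: the eigenvector w then lies in the image of D, w = D
   z, while D w = 0 because every eigenvalue of D is 0. *)
have [v v0] := mulmx_neq0 Dn0.
have [w [a [B [w0 hw wE cB]]]] := eigen_refine D v0.
have a0 := D0 _ _ w0 hw; rewrite a0 scale0r in hw.
pose z := B *m v.
have wz : w = D *m z.
  by rewrite wE /z !mulmxA -[B *m D]/(B * D) -[D *m B]/(D * B) (cB D (commr_refl D)).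
have := expmx_square_zero (D := D) (v := z); rewrite -wz hw eD mul1mx => /(_ erefl) /eqP.
by rewrite -subr_eq0 opprD addrA subrr sub0r oppr_eq0 (negPf w0).
Qed.

End LogUnique.

(** * Bounds on the Cayley transform *)

Lemma cayley_step_identity (A : pzRingType) (C T : A) : GRing.comm C T ->
  C *+ 2 + T * (1 + C) = C * (1 *+ 2 + T * (1 + C)) + T * (1 - C ^+ 2).
Proof.
move=> c; rewrite (mulrDr C) [C * (1 *+ 2)]mulrnAr mulr1 -[RHS]addrA; congr (_ + _).
have -> : C * (T * (1 + C)) = T * (C * (1 + C)) by rewrite mulrA c mulrA.
rewrite -[RHS]mulrDr; congr (_ * _).
by rewrite mulrDr mulr1 -expr2 addrACA subrr addr0 addrC.
Qed.

Lemma add_sub_eq0 (K : numFieldType) (V : lmodType K) (u x : V) :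
  u + x = 0 -> u - x = 0 -> x = 0.
Proof.
move=> h1 h2; have : x *+ 2 = (u + x) - (u - x).
  by rewrite opprB [RHS]addrC -addrA addKr mulr2n.
rewrite h1 h2 subrr -scaler_nat => /eqP.
by rewrite scaler_eq0 pnatr_eq0 /= => /eqP.
Qed.

Lemma half_gap_gt0 (R : realFieldType) (m p k a b c : R) :
  0 <= m -> 0 < p -> k < 1 -> m <= k * p ->
  p ^+ 2 = a + b *+ 2 + c -> m ^+ 2 = a - b *+ 2 + c -> 0 < b.
Proof.
move=> m0 p0 k1 mk pE mE; have mp : m < p by apply: (le_lt_trans mk); rewrite gtr_pMl.
have : m ^+ 2 < p ^+ 2 by nra.
by rewrite pE mE; lra.
Qed.

Section CayleyBounds.
Variables (R : realType) (n : nat) (P : 'M[R[i]]_n.+1).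
Hypothesis hP : posdef P.
Implicit Types (X Y C D L M : 'M[R[i]]_n.+1) (u v w x : 'cV[R[i]]_n.+1).

(** The Cayley transform (M - 1)(M + 1)^-1 has norm at most k, written without the inverse; for 0 <=
    k < 1 invertibility of M + 1 is a consequence. *)
Definition cayley_le M (k : R) :=
  forall x, vnorm P (M *m x - x) <= k * vnorm P (M *m x + x).

Lemma cayley_leW M k k' : k <= k' -> cayley_le M k -> cayley_le M k'.
Proof.
by move=> kk h x; apply: (le_trans (h x)); rewrite ler_wpM2r// vnorm_ge0.
Qed.

Lemma vnorm_sqrD u x :
  vnorm P (u + x) ^+ 2 = rdot P u u + rdot P x u *+ 2 + rdot P x x.
Proof.
rewrite (vnorm_sqr hP) rdotDl (rdotDr P u) (rdotDr P x) (rdotC hP u x).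
by rewrite mulr2n !addrA.
Qed.

Lemma vnorm_sqrB u x :
  vnorm P (u - x) ^+ 2 = rdot P u u - rdot P x u *+ 2 + rdot P x x.
Proof.
by rewrite vnorm_sqrD rdotNl (rdotNl P x (- x)) (rdotNr P x x) opprK mulNrn.
Qed.

(** Polarization: |u + x|^2 - |u - x|^2 is four times [rdot P x u]. This is how |C| < 1 returns to
    L_P. *)
Lemma rdot_of_cayley u x k : k < 1 -> vnorm P (u - x) <= k * vnorm P (u + x) ->
  x != 0 -> 0 < rdot P x u.
Proof.
move=> k1 hk x0.
have [z|z] := eqVneq (u + x) 0.
  move: hk; rewrite z vnorm0 mulr0 => /(vnorm_eq0 hP) z'.
  by move/eqP: x0; have := add_sub_eq0 z z'.
have p3 := vnorm_gt0 hP z; have p2 := vnorm_ge0 P (u - x).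
exact: (half_gap_gt0 p2 p3 k1 hk (vnorm_sqrD u x) (vnorm_sqrB u x)).
Qed.

(** If (M + 1) v = 0, the bound forces (M - 1) v = 0 as well, hence v = 0. C is a rational function
    of M, whence the commutation. *)
Lemma cayley_inv M k : 0 <= k < 1 -> cayley_le M k ->
  exists C, [/\ ob P C k, M * (1 - C) = 1 + C &
    forall Y, GRing.comm Y M -> GRing.comm Y C].
Proof.
move=> /andP[k0 k1] h.
have U : M + 1 \is a GRing.unit.
  rewrite -[_ \is a _]/(_ \in unitmx) -unitmx_tr -row_free_unit -kermx_eq0.
  apply/rowV0P => v /sub_kermxP hv.
  have hv' : M *m v^T + v^T = 0.
    have := congr1 trmx hv; rewrite trmx_mul trmxK trmx0 mulmxDl.
    by rewrite -[1]/(1%:M) mul1mx.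
  have := h v^T; rewrite hv' vnorm0 mulr0 => /(vnorm_eq0 hP) hv2.
  by apply: trmx_inj; rewrite trmx0; exact: (add_sub_eq0 hv' hv2).
pose C := (M - 1) * (M + 1)^-1.
exists C; split.
- move=> x; rewrite /C -[_ * _]/(_ *m _) -mulmxA.
  set y := (M + 1)^-1 *m x.
  have -> : x = (M + 1) *m y.
    by rewrite /y mulmxA -[(M + 1) *m _]/(_ * _) divrr// mul1mx.
  by have := h y; rewrite !mulmxDl mulNmx -[1]/(1%:M) !mul1mx.
- have e1 : 1 - C = (M + 1)^-1 *+ 2.
    rewrite /C -[X in X - _](divrr U) -mulrBl opprB [1 - M]addrC addrACA addrN add0r.
    by rewrite mulrDl mul1r mulr2n.
  have e2 : 1 + C = M * (M + 1)^-1 *+ 2.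
    rewrite /C -[X in X + _](divrr U) -mulrDl addrACA addrN addr0.
    by rewrite mulrDl mulr2n.
  by rewrite e1 e2 mulrnAr.
- move=> Y c; apply: commrM; first exact: (commrB c (commr1 Y)).
  by apply: commrV; exact: (commrD c (commr1 Y)).
Qed.

Lemma clog_strip C (k : R) v (l : R[i]) : ob P C k -> k < 1 -> v != 0 ->
  clog C *m v = l *: v -> `|complex.Im l| < pi / 2.
Proof.
move=> h k1 v0 hl.
have [w [a [B [w0 hw wE cB]]]] := eigen_refine C v0.
have hw' : clog C *m w = l *: w.
  rewrite wE; apply: comm_eigenvector hl; apply: cB; apply: commr_sym.
  exact: (clog_comm hP h k1 (commr_refl C)).
exact: (clog_eigen hP h k1 w0 hw hw').
Qed.

Lemma right_cancel_sub C (k : R) X Y : ob P C k -> k < 1 ->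
  X * (1 - C) = Y * (1 - C) -> X = Y.
Proof.
move=> h k1 e; have [G [_ G1 _]] := neumann hP h k1.
have G2 : (1 - C) * G = 1 by exact: (mulmx1C G1).
by rewrite -[X]mulr1 -[Y]mulr1 -G2 !mulrA e.
Qed.

(** The given L is recovered, not merely some logarithm of exp L: L and [clog C] commute, have the
    same exponential and both have spectrum in |Im| < pi. *)
Lemma clog_of_exp L (k : R) : 0 <= k < 1 -> cayley_le (expmx L) k ->
  (forall l v, v != 0 -> L *m v = l *: v -> `|complex.Im l| < pi) ->
  exists C, [/\ ob P C k, expmx L * (1 - C) = 1 + C & L = clog C].
Proof.
move=> kk h hL; have [C [oC eC cC]] := cayley_inv kk h.
case/andP: kk => k0 k1.
exists C; split => //.
have eE : expmx (clog C) = expmx L.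
  by exact: (right_cancel_sub oC k1 (etrans (expmx_clog hP oC k1) (esym eC))).
apply: (expmx_inj_strip hP _ (esym eE) hL).
  apply: (clog_comm hP oC k1); apply: cC; apply: (expmx_comm hP); exact: commr_refl.
move=> l v v0 hl; have := clog_strip oC k1 v0 hl; have := pi_gt0 R; lra.
Qed.

Lemma log_exists M (k : R) : 0 <= k < 1 -> cayley_le M k ->
  exists L, expmx L = M /\
    forall l v, v != 0 -> L *m v = l *: v -> `|complex.Im l| < pi.
Proof.
move=> kk h; have [C [oC eC _]] := cayley_inv kk h; case/andP: kk => k0 k1.
exists (clog C); split.
  by exact: (right_cancel_sub oC k1 (etrans (expmx_clog hP oC k1) (esym eC))).
move=> l v v0 hl; have := clog_strip oC k1 v0 hl; have := pi_gt0 R; lra.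
Qed.

End CayleyBounds.

(** * One Euler step for the Cayley transform of exp (g L) *)

Lemma addr_add_sub (V : zmodType) (a b : V) : a + b + (a - b) = a *+ 2.
Proof. by rewrite addrACA subrr addr0. Qed.

Lemma addr_sub_sub (V : zmodType) (a b : V) : a + b - (a - b) = b *+ 2.
Proof. by rewrite opprB [b - a]addrC addrACA subrr add0r. Qed.

(** This is 1 / (1 - 2 e) <= 1 + 4 e for 4 e <= 1, which bounds the inverse of the denominator of
    the new transform. *)
Lemma half_shift_bound (R : realFieldType) (e z w : R) : 0 <= z -> 0 <= e ->
  4 * e <= 1 -> 2 * z - 2 * e * 2 * z <= w -> 2 * z <= (1 + 4 * e) * w.
Proof.
move=> z0 e0 e4 hw; have h4 : 0 <= 1 - 4 * e by lra.
have h1 : 0 <= 1 + 4 * e by lra.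
have := ler_wpM2l h1 hw; have := mulr_ge0 (mulr_ge0 z0 e0) h4; lra.
Qed.

Lemma scaled_le (R : realFieldType) (S q z w : R) : 0 <= S ->
  2 * z <= q * w -> 2 * S * z <= S * q * w.
Proof. by move=> S0 h; rewrite mulrAC mulrC -[leRHS]mulrA ler_wpM2l. Qed.

Section Step.
Variables (R : realType) (n : nat) (P : 'M[R[i]]_n.+1).
Hypothesis hP : posdef P.
Implicit Types (X Y C D L M : 'M[R[i]]_n.+1) (u v w x z : 'cV[R[i]]_n.+1).

(* The Cayley transform C of exp (g L) satisfies g C' = artanh C * (1 - C^2),
   which clog_bound bounds by k + k^3; this is one Euler step of that inequality. *)
Lemma cayley_step_bound L C (l k g e : R) :
  ob P L l -> ob P C k -> k < 1 -> 0 < g -> 0 <= e -> 4 * (e * l) <= 1 ->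
  g%:C *: L = clog C -> expmx (g%:C *: L) * (1 - C) = 1 + C ->
  cayley_le P (expmx ((g + e)%:C *: L))
    (k + (e / g * (k + k ^+ 3) + (e * l) ^+ 2) * (1 + 4 * (e * l))).
Proof.
move=> oL oC k1 g0 e0 el gL eC; have k0 := ob_ge0 hP oC; have l0 := ob_ge0 hP oL.
pose d := e * l; have d0 : 0 <= d by rewrite mulr_ge0.
have od : ob P (e%:C *: L) d.
  by have := obZr e oL; rewrite (ger0_norm e0).
have d1 : d <= 1 by rewrite -/d in el; lra.
have oQ := expmx_quadratic hP od d1.
pose T := expmx (e%:C *: L) - 1.
pose Q := expmx (e%:C *: L) - 1 - e%:C *: L.
have TE : T = e%:C *: L + Q by rewrite /Q addrC subrK.
have eL : e%:C *: L = (e / g)%:C *: clog C.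
  rewrite -gL scalerA -rmorphM; congr (_%:C *: _).
  by rewrite divfK// gt_eqF.
have cC : GRing.comm C (clog C) := clog_comm hP oC k1 (commr_refl C).
have cLC : GRing.comm C (e%:C *: L) by rewrite eL; apply: comm_scale.
have cT : GRing.comm C T.
  by apply: commrB; [exact: (expmx_comm hP cLC) | exact: commr1].
have oT : ob P T (2 * d).
  rewrite TE; apply: (ob_le _ (obD hP od oQ)); nra.
have o1C : ob P (1 + C) 2 by apply: (ob_le _ (obD hP (ob1 P) oC)); lra.
have oC2 : ob P (1 - C ^+ 2) 2.
  apply: (ob_le _ (obB hP (ob1 P) (obX hP 2 oC))); nra.
(* The first-order part of T is (e / g) [clog C], to which [clog_bound] applies; the rest Q is
   quadratic in e. *)
have oTC : ob P (T * (1 - C ^+ 2)) (2 * (e / g * (k + k ^+ 3) + d ^+ 2)).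
  rewrite TE mulrDl.
  have -> : e%:C *: L * (1 - C ^+ 2) = (e / g)%:C *: (((1 - C ^+ 2) * clog C - C *+ 2) + C *+ 2).
    rewrite subrK eL -scalerAl; congr (_ *: _).
    have c2 : GRing.comm (clog C) (1 - C ^+ 2).
      by apply: commrB; [exact: commr1 | exact: (commrX 2 (commr_sym cC))].
    exact: c2.
  have o2C : ob P (C *+ 2) (k + k) by rewrite mulr2n; exact: (obD hP oC oC).
  have oa := obZr (e / g) (obD hP (clog_bound hP oC k1) o2C).
  apply: (ob_le _ (obD hP oa (obM hP oQ oC2))).
  rewrite ger0_norm; last by rewrite divr_ge0// ltW.
  by rewrite le_eqVlt; apply/orP; left; apply/eqP; ring.
have eE : expmx ((g + e)%:C *: L) = (1 + T) * expmx (g%:C *: L).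
  rewrite /T [1 + _]addrC subrK -(expmxD hP).
    by rewrite addrC -scalerDl -rmorphD.
  by apply: comm_scale; apply/commr_sym; apply: comm_scale; exact: commr_refl.
have [G [_ G1 _]] := neumann hP oC k1.
have G2 : (1 - C) * G = 1 by exact: (mulmx1C G1).
(* With x = (1 - C) z and M' the new exponential, (M' + 1) x = W z and (M' - 1) x = (C W + T (1 -
   C^2)) z. The new transform is thus C + T (1 - C^2) W^-1, and W is close to 2. *)
move=> x; pose z := G *m x.
have xE : x = (1 - C) *m z by rewrite /z mulmxA -[(1 - C) *m G]/(_ * _) G2 mul1mx.
have MxE : expmx ((g + e)%:C *: L) *m x = ((1 + T) * (1 + C)) *m z.
  by rewrite eE {1}xE mulmxA -[_ *m (1 - C)]/(_ * _) -mulrA eC.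
pose W := 1 *+ 2 + T * (1 + C) : 'M[R[i]]_n.+1.
have wE : expmx ((g + e)%:C *: L) *m x + x = W *m z.
  rewrite MxE {1}xE -mulmxDl; congr (_ *m _).
  by rewrite [(1 + T) * _]mulrDl mul1r /W [LHS]addrAC (addr_add_sub 1 C).
have uE : expmx ((g + e)%:C *: L) *m x - x = C *m (W *m z) + (T * (1 - C ^+ 2)) *m z.
  rewrite MxE {1}xE -mulmxBl mulmxA -mulmxDl; congr (_ *m _).
  rewrite -[C *m W]/(C * W) -(cayley_step_identity cT).
  by rewrite [(1 + T) * _]mulrDl mul1r [LHS]addrAC (addr_sub_sub 1 C).
rewrite uE wE; apply: (le_trans (vnormD hP _ _)).
rewrite [leRHS]mulrDl; apply: lerD; first exact: oC.
apply: (le_trans (oTC z)).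
have hz : 2 * vnorm P z <= (1 + 4 * d) * vnorm P (W *m z).
  apply: half_shift_bound => //; first exact: vnorm_ge0.
  rewrite /W mulmxDl.
  have -> : (1 *+ 2 : 'M[R[i]]_n.+1) *m z = z + z by rewrite mulr2n mulmxDl mul1mx.
  rewrite -[(T * (1 + C)) *m z]opprK.
  apply: le_trans (vnormB hP _ _); rewrite vnormN.
  have hT := obM hP oT o1C z.
  have -> : z + z = 2%:R%:C *: z by rewrite rmorph_nat scaler_nat mulr2n.
  rewrite vnormZ normcR ger0_norm//; exact: (lerB (lexx _) hT).
apply: scaled_le hz.
by rewrite addr_ge0 ?sqr_ge0// mulr_ge0 ?divr_ge0 ?addr_ge0 ?exprn_ge0// ltW.
Qed.

End Step.

(** * The scalar majorant of the Euler steps *)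

Section Comparison.
Variable R : realType.
Implicit Types (a b g e l k d : R).

(* For u = k^2 the inequality g k' <= k + k^3 reads g u' <= 2 u (1 + u), and
   a g^2 / (1 - a g^2) solves the corresponding equation; replacing the second a
   by b > a leaves room for the error of the Euler steps. *)
Definition majorant2 a b g : R := a * g ^+ 2 / (1 - b * g ^+ 2).
Definition majorant a b g : R := Num.sqrt (majorant2 a b g).

Lemma euler_square k d e q : 0 <= k <= 1 -> 0 <= d <= 2 -> 0 <= e <= 1 -> 0 <= q ->
  (k + e * d + e ^+ 2 * q) ^+ 2 <=
  k ^+ 2 + 2 * e * (k * d) + e ^+ 2 * (4 + 6 * q + q ^+ 2).
Proof.
move=> /andP[k0 k1] /andP[d0 d2] /andP[e0 e1] q0.
have -> : (k + e * d + e ^+ 2 * q) ^+ 2 = k ^+ 2 + 2 * e * (k * d) +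
  e ^+ 2 * (d ^+ 2 + 2 * k * q + 2 * e * d * q + e ^+ 2 * q ^+ 2) by ring.
(* The constant 4 + 6 q + q^2 collects d^2 <= 4, 2 k q <= 2 q, 2 e d q <= 4 q and e^2 q^2 <= q^2. *)
rewrite lerD2l ler_wpM2l ?sqr_ge0//.
have h1 : d ^+ 2 <= 4 by nra.
have h2 : k * q <= q by rewrite ler_piMl.
have h3 : e * d <= 2 by nra.
have h4 : e * d * q <= 2 * q by rewrite ler_wpM2r.
have h5 : e ^+ 2 * q ^+ 2 <= q ^+ 2 by rewrite ler_piMl ?sqr_ge0 ?exprn_ile1.
lra.
Qed.

(** With D = 1 - b g^2, the slope of [majorant2] is 2 a g / D^2. It exceeds the slope 2 (m + m^2) /
    g of the differential inequality by 2 a (b - a) g^3 / D^2, which is at least 2 a (b - a) since g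
    >= 1 and D <= 1. *)
Lemma majorant2_increment a b g e : 0 < a -> a < b -> 1 <= g -> 0 <= e ->
  b * (g + e) ^+ 2 < 1 ->
  majorant2 a b g + 2 * e * ((majorant2 a b g + majorant2 a b g ^+ 2) / g) +
    e * (2 * a * (b - a)) <= majorant2 a b (g + e).
Proof.
move=> a0 ab g1 e0 hD'; have b0 : 0 < b by apply: lt_trans ab.
have g0 : 0 < g by apply: lt_le_trans g1.
have hg : g ^+ 2 <= (g + e) ^+ 2 by nra.
have hD : b * g ^+ 2 < 1 by apply: le_lt_trans hD'; rewrite ler_pM2l.
rewrite /majorant2; set D := 1 - b * g ^+ 2.
have D0 : 0 < D by rewrite subr_gt0.
have bg : b * g ^+ 2 = 1 - D by rewrite /D; ring.
have bg0 : 0 <= b * g ^+ 2 by rewrite mulr_ge0 ?sqr_ge0// ltW.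
have D1 : D <= 1 by lra.
pose i := D^-1; have iD : D * i = 1 by rewrite divff// gt_eqF.
have i1 : 1 <= i by rewrite -invr1 lef_pV2 ?posrE.
have D'0 : 0 < 1 - b * (g + e) ^+ 2 by rewrite subr_gt0.
rewrite ler_pdivlMr//.
have -> : 1 - b * (g + e) ^+ 2 = D - b * (2 * g * e + e ^+ 2) by rewrite /D; ring.
rewrite -/i.
have -> : (a * g ^+ 2 * i + (a * g ^+ 2 * i) ^+ 2) / g =
   a * g * (D + a * g ^+ 2) * i ^+ 2.
  have -> : a * g * (D + a * g ^+ 2) * i ^+ 2 =
    a * g * (D * i * i) + a ^+ 2 * g ^+ 3 * i ^+ 2 by ring.
  by rewrite iD mul1r; field; rewrite gt_eqF.
(* The intermediate value is the tangent of [majorant2] at g, with denominators cleared; by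
   convexity it lies below the graph. *)
apply: (@le_trans _ _ ((a * g ^+ 2 * i + 2 * a * g * e * i ^+ 2) *
   (D - b * (2 * g * e + e ^+ 2)))).
  apply: ler_wpM2r; first by rewrite /D; lra.
  rewrite -addrA lerD2l.
  have -> : 2 * e * (a * g * (D + a * g ^+ 2) * i ^+ 2) =
    2 * a * g * e * i ^+ 2 - e * (2 * a * (b - a)) * (g ^+ 3 * i ^+ 2).
    have -> : D = 1 - b * g ^+ 2 by []. ring.
  have h1 : 1 <= g ^+ 3 * i ^+ 2.
    by rewrite -[1]mulr1 ler_pM// exprn_ege1.
  have h2 : 0 <= e * (2 * a * (b - a)).
    by rewrite mulr_ge0// mulr_ge0 ?subr_ge0 ?ltW// mulr_gt0.
  have := ler_wpM2l h2 h1; lra.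
have -> : (a * g ^+ 2 * i + 2 * a * g * e * i ^+ 2) * (D - b * (2 * g * e + e ^+ 2)) =
   a * (g ^+ 2 * (D * i) + 2 * g * e * i * (D * i)
     - (b * g ^+ 2) * i * (2 * g * e + e ^+ 2)
     - 2 * g * e * i ^+ 2 * b * (2 * g * e + e ^+ 2)) by ring.
rewrite bg iD; apply: ler_wpM2l; first exact: ltW.
have -> : (1 - D) * i * (2 * g * e + e ^+ 2) = (i - D * i) * (2 * g * e + e ^+ 2) by ring.
rewrite iD.
have h1 : 0 <= 2 * g * e by rewrite mulr_ge0// mulr_ge0// ltW.
have h2 : 0 <= 2 * g * e * i ^+ 2 * b * (2 * g * e + e ^+ 2).
  by rewrite mulr_ge0 ?addr_ge0 ?sqr_ge0// mulr_ge0 ?(ltW b0)// mulr_ge0// sqr_ge0.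
have h3 : 0 <= (i - 1) * e ^+ 2 by rewrite mulr_ge0 ?subr_ge0 ?sqr_ge0.
have := sqr_ge0 e; lra.
Qed.

Lemma majorant_range a b g : 0 < a -> 0 < b -> (a + b) * g ^+ 2 < 1 ->
  [/\ 0 <= majorant2 a b g, majorant2 a b g < 1,
      0 <= majorant a b g & majorant a b g < 1].
Proof.
move=> a0 b0 h; have g2 := sqr_ge0 g.
have D0 : 0 < 1 - b * g ^+ 2 by nra.
have m0 : 0 <= majorant2 a b g.
  by apply: divr_ge0; [exact: (mulr_ge0 (ltW a0) g2) | exact: ltW].
have m1 : majorant2 a b g < 1 by rewrite ltr_pdivrMr// mul1r; lra.
split => //; first exact: sqrtr_ge0.
by rewrite -sqrtr1 ltr_sqrt.
Qed.

(** The step bound e0 is uniform in g, so that the number of steps up to G can be fixed in advance.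
    The gain is linear in e, the Euler error quadratic. *)
Lemma majorant_step a b l G : 0 < a -> a < b -> 0 <= l -> (a + b) * G ^+ 2 < 1 ->
  exists2 e0, 0 < e0 <= 1 & forall g e, 1 <= g -> 0 <= e <= e0 -> g + e <= G ->
    4 * (e * l) <= 1 /\
    majorant a b g + (e / g * (majorant a b g + majorant a b g ^+ 3) + (e * l) ^+ 2)
      * (1 + 4 * (e * l)) <= majorant a b (g + e).
Proof.
move=> a0 ab l0 hG; have b0 : 0 < b by apply: lt_trans ab.
(* Quadratic errors of the step: 4 e^2 l d <= 8 e^2 l from d <= 2, and (e l)^2 (1 + 4 e l) <= 2 (e
   l)^2. *)
pose q := 8 * l + 2 * l ^+ 2.
have q0 : 0 <= q by rewrite addr_ge0 ?mulr_ge0 ?sqr_ge0.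
pose K := 4 + 6 * q + q ^+ 2.
have K0 : 0 < K by have := sqr_ge0 q; rewrite /K; lra.
pose c := 2 * a * (b - a).
have c0 : 0 < c by rewrite mulr_gt0 ?subr_gt0// mulr_gt0.
have l4 : 0 < 4 * l + 1 by lra.
(* The second entry gives 4 e l <= 1; the third gives e^2 K <= e c, so the gain absorbs the
   error. *)
exists (Num.min 1 (Num.min (4 * l + 1)^-1 (c / K))).
  by rewrite !lt_min ltr01 invr_gt0 l4 divr_gt0//= ge_min lexx.
move=> g e g1 /andP[e0]; rewrite !le_min => /and3P[e1 el eK] geG.
have g0 : 0 < g by apply: lt_le_trans g1.
have hel : 4 * (e * l) <= 1.
  have : e * (4 * l + 1) <= 1 by rewrite -ler_pdivlMr// mul1r.
  lra.
split => //.
have hge : (a + b) * (g + e) ^+ 2 < 1.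
  apply: le_lt_trans hG; rewrite ler_pM2l ?addr_gt0//; nra.
have hg : (a + b) * g ^+ 2 < 1.
  apply: le_lt_trans hge; rewrite ler_pM2l ?addr_gt0//; nra.
have [m0 m1 k0 k1] := majorant_range a0 b0 hg.
have k2 : majorant a b g ^+ 2 = majorant2 a b g by rewrite sqr_sqrtr.
have [n0 _ k0' _] := majorant_range a0 b0 hge.
have hinc : majorant2 a b g + 2 * e * ((majorant2 a b g + majorant2 a b g ^+ 2) / g) +
    e * c <= majorant2 a b (g + e).
  by apply: majorant2_increment => //; have := sqr_ge0 (g + e); nra.
set k := majorant a b g in k0 k1 k2 *.
pose d := (k + k ^+ 3) / g.
have d0 : 0 <= d by rewrite divr_ge0 ?addr_ge0 ?exprn_ge0 ?(ltW g0).
have k3 : k ^+ 3 <= 1 by rewrite exprn_ile1// ltW.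
have d2 : d <= 2 by rewrite ler_pdivrMr//; lra.
have -> : e / g * (k + k ^+ 3) = e * d by rewrite /d; ring.
have kd : k * d = (majorant2 a b g + majorant2 a b g ^+ 2) / g.
  by rewrite -k2 /d; ring.
apply: (@le_trans _ _ (k + e * d + e ^+ 2 * q)).
  rewrite -addrA lerD2l /q.
  have h1 : e ^+ 2 * l * d <= e ^+ 2 * l * 2.
    by rewrite ler_wpM2l// mulr_ge0// sqr_ge0.
  have h2 : (e * l) ^+ 2 * (4 * (e * l)) <= (e * l) ^+ 2.
    by rewrite ler_piMr// sqr_ge0.
  have -> : (e * d + (e * l) ^+ 2) * (1 + 4 * (e * l)) = e * d + 4 * (e ^+ 2 * l * d) +
     (e * l) ^+ 2 + (e * l) ^+ 2 * (4 * (e * l)) by ring.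
  have -> : e ^+ 2 * (8 * l + 2 * l ^+ 2) = 4 * (e ^+ 2 * l * 2) + 2 * (e * l) ^+ 2 by ring.
  lra.
have p0 : 0 <= k + e * d + e ^+ 2 * q.
  by rewrite !addr_ge0// mulr_ge0// sqr_ge0.
rewrite -(ger0_norm p0) -sqrtr_sqr ler_sqrt//.
have kk : 0 <= k <= 1 by rewrite k0 ltW.
have dd : 0 <= d <= 2 by rewrite d0.
have ee : 0 <= e <= 1 by rewrite e0.
apply: (le_trans (euler_square kk dd ee q0)); rewrite -/K.
apply: le_trans hinc; rewrite k2 kd lerD2l expr2 -mulrA ler_wpM2l//.
by rewrite -ler_pdivlMr.
Qed.

End Comparison.

(** * Continuation of the Cayley bound from exp L to exp (g L) *)

Section Continuation.
Variables (R : realType) (n : nat) (P : 'M[R[i]]_n.+1).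
Hypothesis hP : posdef P.
Implicit Types (L M : 'M[R[i]]_n.+1) (v : 'cV[R[i]]_n.+1).

Definition in_strip L :=
  forall (l : R[i]) v, v != 0 -> L *m v = l *: v -> `|complex.Im l| < pi.

Lemma Im_scale (c : R) (z : R[i]) : complex.Im (c%:C * z) = c * complex.Im z.
Proof. by case: z => a b /=; rewrite mul0r addr0. Qed.

(** Being [clog C], g L has spectrum in |Im| < pi/2, and a factor of at most 2 keeps it in |Im| <
    pi. *)
Lemma strip_scale L C (k g g' : R) : ob P C k -> k < 1 -> g%:C *: L = clog C ->
  0 < g -> 0 < g' -> g' <= 2 * g -> in_strip (g'%:C *: L).
Proof.
move=> oC k1 e g0 g'0 gg l v v0 hl.
have hv : clog C *m v = ((g / g')%:C * l) *: v.
  rewrite -e -scalerA -hl -!scalemxAl scalerA -rmorphM /=.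
  by rewrite divfK// gt_eqF.
have := clog_strip hP oC k1 v0 hv; rewrite Im_scale normrM ger0_norm; last first.
  by rewrite divr_ge0// ltW.
have h1 : 1 / 2 <= g / g' by rewrite ler_pdivlMr// mulrC; lra.
have h2 := normr_ge0 (complex.Im l).
have := ler_wpM2r h2 h1; lra.
Qed.

Lemma cayley_continuation L (a b G g : R) : 0 < a -> a < b ->
  (a + b) * G ^+ 2 < 1 -> 1 <= g <= G -> in_strip L ->
  cayley_le P (expmx L) (majorant a b 1) ->
  cayley_le P (expmx (g%:C *: L)) (majorant a b g).
Proof.
move=> a0 ab hG /andP[g1 gG] hL h1; have [l oL] := ob_ex hP L.
have b0 : 0 < b by apply: lt_trans ab.
have [e0 /andP[e00 e01] hstep] := majorant_step a0 ab (ob_ge0 hP oL) hG.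
pose N := (Num.trunc ((g - 1) / e0)).+1.
have N0 : 0 < N%:R :> R by rewrite ltr0n.
pose e := (g - 1) / N%:R.
have e_ge0 : 0 <= e by rewrite divr_ge0 ?subr_ge0// ltW.
have ee0 : e <= e0.
  rewrite ler_pdivrMr// mulrC -ler_pdivrMr//; apply: ltW.
  exact: truncnS_gt.
have eN : 1 + N%:R * e = g by rewrite /e mulrCA divff ?gt_eqF// mulr1 addrC subrK.
(* The strip belongs to the induction because [clog_of_exp] needs it at each step; it survives since
   e <= 1 <= gj gives gj + e <= 2 gj. *)
suff H j : (j <= N)%N -> in_strip ((1 + j%:R * e)%:C *: L) /\
    cayley_le P (expmx ((1 + j%:R * e)%:C *: L)) (majorant a b (1 + j%:R * e)).
  by have := (H N (leqnn N)).2; rewrite eN.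
elim: j => [|j IH] jN; first by rewrite mul0r addr0 scale1r.
have [hs hc] := IH (ltnW jN).
set gj := 1 + j%:R * e in hs hc *.
have -> : 1 + j.+1%:R * e = gj + e by rewrite /gj -natr1; ring.
have gj1 : 1 <= gj by rewrite /gj lerDl mulr_ge0.
have gjG : gj + e <= G.
  apply: le_trans gG; rewrite -eN /gj -addrA lerD2l.
  have -> : j%:R * e + e = j.+1%:R * e by rewrite -natr1; ring.
  by rewrite ler_wpM2r// ler_nat.
have gj0 : 0 < gj by apply: lt_le_trans gj1.
have hgj : (a + b) * gj ^+ 2 < 1.
  apply: le_lt_trans hG; rewrite ler_pM2l ?addr_gt0// ler_pXn2r// ?nnegrE.
  - by apply: le_trans gjG; rewrite lerDl.
  - exact: ltW.
  - by apply: le_trans gjG; rewrite addr_ge0// ltW.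
have [_ _ k0 k1] := majorant_range a0 b0 hgj.
have kk : 0 <= majorant a b gj < 1 by rewrite k0.
have [C [oC eC LC]] := clog_of_exp hP kk hc hs.
have ee : 0 <= e <= e0 by rewrite e_ge0.
have [el hm] := hstep gj e gj1 ee gjG.
split; last first.
  apply: (cayley_leW hm).
  exact: (cayley_step_bound hP oL oC k1 gj0 e_ge0 el LC eC).
apply: (strip_scale oC k1 LC gj0); lra.
Qed.

End Continuation.

(** * The sets L_P(eta): parts (ii) and (iii) *)

Lemma form_split (K : comNzRingType) m (y : 'rV[K]_m) (x : 'cV[K]_m)
    (B1 B2 B3 B4 : 'M[K]_m) (c : K) :
  (y *m (B1 + B2 - c *: (B3 + B4)) *m x) 0 0 =
  (y *m B1 *m x) 0 0 + (y *m B2 *m x) 0 0 -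
    c * ((y *m B3 *m x) 0 0 + (y *m B4 *m x) 0 0).
Proof.
by rewrite !(mulmxBr, mulmxBl, mulmxDr, mulmxDl) -scalemxAr -scalemxAl
  !(mulmxDr, mulmxDl) !mxE.
Qed.

Section LyapunovSets.
Variables (R : realType) (n : nat) (P : 'M[R[i]]_n.+1).
Hypothesis hP : posdef P.
Implicit Types (A L M : 'M[R[i]]_n.+1) (x v : 'cV[R[i]]_n.+1).

Lemma hermitian_form_conj M x : M \is hermsymmx ->
  Num.conj_op ((x^t* *m M *m x) 0 0) = (x^t* *m M *m x) 0 0.
Proof.
move=> /hermsymmxP hM; have -> : Num.conj_op ((x^t* *m M *m x) 0 0) = ((x^t* *m M *m x)^t*) 0 0.
  by rewrite !mxE.
by rewrite !trC_mul trmxCK hM mulmxA.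
Qed.

Lemma hermitian_form_real M x : M \is hermsymmx ->
  (x^t* *m M *m x) 0 0 = (complex.Re ((x^t* *m M *m x) 0 0))%:C.
Proof.
move=> /(hermitian_form_conj x); rewrite conjCE; case: (_ 0 0) => a b /= [h].
by congr (_ +i* _)%C; lra.
Qed.

Lemma posdef_Re M : M \is hermsymmx ->
  (forall x, x != 0 -> 0 < complex.Re ((x^t* *m M *m x) 0 0)) -> posdef M.
Proof.
by move=> hM h; split => // x x0; rewrite (hermitian_form_real x hM) ltcR h.
Qed.

Lemma lyap_form A (c : R) x :
  complex.Re ((x^t* *m (P *m A + A^t* *m P - c%:C *: (A^t* *m P *m A + P)) *m x) 0 0) =
  2 * rdot P x (A *m x) - c * (rdot P (A *m x) (A *m x) + rdot P x x).
Proof.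
have e1 : complex.Re ((x^t* *m (P *m A) *m x) 0 0) = rdot P x (A *m x).
  by rewrite /rdot !mulmxA.
have e2 : complex.Re ((x^t* *m (A^t* *m P) *m x) 0 0) = rdot P x (A *m x).
  by rewrite (rdotC hP) /rdot trC_mul !mulmxA.
have e3 : complex.Re ((x^t* *m (A^t* *m P *m A) *m x) 0 0) = rdot P (A *m x) (A *m x).
  by rewrite /rdot trC_mul !mulmxA.
have lin (p q r t u s : R) : p = t -> q = t -> r = u ->
    p + q - c * (r + s) = 2 * t - c * (u + s) by move=> -> -> ->; ring.
rewrite form_split ReB ReD ReZ ReD.
exact: (lin _ _ _ _ _ (rdot P x x) e1 e2 e3).
Qed.

Lemma lyap_hermitian A (c : R) :
  P *m A + A^t* *m P - c%:C *: (A^t* *m P *m A + P) \is hermsymmx.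
Proof.
case: (hP) => /hermsymmxP hh _; apply/hermsymmxP.
rewrite trC_add trC_opp trC_scale !trC_add !trC_mul trmxCK hh mulmxA.
by rewrite [A^t* *m P + _]addrC conjCE conjc_real.
Qed.

Lemma lyapP A (eta : \bar R) : lyap P eta A <->
  forall x, x != 0 -> fine (inve eta) * (rdot P (A *m x) (A *m x) + rdot P x x) <
    2 * rdot P x (A *m x).
Proof.
rewrite /lyap /loewner_gt /=; split=> [[_ h] x /h|h].
  by rewrite ltcE => /andP[_]; rewrite lyap_form subr_gt0.
apply: posdef_Re; first exact: lyap_hermitian.
by move=> x /h; rewrite lyap_form subr_gt0.
Qed.

Lemma fine_inve_oo : fine (inve +oo%E) = 0 :> R.
Proof. by rewrite /inve. Qed.

Lemma fine_inve_fin (r : R) : r != 0 -> fine (inve r%:E) = r^-1.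
Proof. by move=> r0; rewrite /inve (negPf r0). Qed.

Lemma lyap_ooP A : lyap P +oo%E A <-> forall x, x != 0 -> 0 < rdot P x (A *m x).
Proof.
split=> [/lyapP h x /h|h]; first by rewrite fine_inve_oo mul0r pmulr_rgt0.
by apply/lyapP => x /h; rewrite fine_inve_oo mul0r pmulr_rgt0.
Qed.

Lemma rdot_eigen A v (l : R[i]) : A *m v = l *: v ->
  rdot P v (A *m v) = complex.Re l * rdot P v v /\
  rdot P (A *m v) (A *m v) = Normc.normc l ^+ 2 * rdot P v v.
Proof.
move=> ->; split; last by rewrite rdotZZ.
rewrite /rdot -scalemxAr mxE; case: (hP) => hh _.
rewrite {1}(hermitian_form_real v hh) mulrC ReZ mulrC.
by [].
Qed.

Lemma lyap_eigenvalue A (eta : \bar R) (l : R[i]) : lyap P eta A -> spec A l ->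
  fine (inve eta) * (Normc.normc l ^+ 2 + 1) < 2 * complex.Re l.
Proof.
move=> /lyapP h /eigenvalue_colP [v v0 hv].
have [e1 e2] := rdot_eigen hv; have := h v v0; rewrite e1 e2.
have q0 := rdot_gt0 hP v0.
set q := rdot P v v in q0 *; set m := Normc.normc l.
have -> : fine (inve eta) * (m ^+ 2 * q + q) = fine (inve eta) * (m ^+ 2 + 1) * q by ring.
by rewrite mulrA ltr_pM2r.
Qed.

Lemma lyap_spec A (eta : \bar R) : (1%:E < eta)%E -> lyap P eta A ->
  spec A `<=` Dinv eta.
Proof.
case: eta => [r| |//] h1 hA l hl; have := lyap_eigenvalue hA hl; last first.
  by rewrite fine_inve_oo mul0r pmulr_rgt0.
rewrite lte_fin in h1; have r0 : 0 < r by apply: lt_trans h1.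
(* Completing the square turns |l|^2 + 1 < 2 r Re l into |l - r|^2 < r^2 - 1. *)
rewrite fine_inve_fin ?gt_eqF// ltr_pdivrMl// => h.
have q : 0 < r ^+ 2 - 1 by rewrite subr_gt0 expr_gt1// ltW.
rewrite /Dinv /= -(ltr_pXn2r (ltn0Sn 1)) ?nnegrE ?normc_ge0 ?sqrtr_ge0//.
rewrite sqr_sqrtr ?ltW// normc_sqr; move: h; rewrite normc_sqr.
by case: l {hl} => x y /=; rewrite subr0; nra.
Qed.

(** In [lyap_cayley] the numbers S + 2 t and S - 2 t are |A x + x|^2 and |A x - x|^2. The hypothesis
    gives their ratio the bound (r - 1)/(r + 1) = a / (1 - a), which is below the initial value a /
    (1 - b) of the majorant. *)
Lemma rate_bound (r S t : R) : 1 < r -> 0 <= S -> r^-1 * S < 2 * t ->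
  S - t *+ 2 <= majorant2 ((r - 1) / (2 * r)) ((r - 1) * (r + 2) / (2 * r ^+ 2)) 1 *
    (S + t *+ 2).
Proof.
move=> r1 S0; have r0 : 0 < r by apply: lt_trans r1.
rewrite ltr_pdivrMl// => h.
have D0 : 0 < r ^+ 2 - r + 2 by nra.
have -> : majorant2 ((r - 1) / (2 * r)) ((r - 1) * (r + 2) / (2 * r ^+ 2)) 1 =
  r * (r - 1) / (r ^+ 2 - r + 2).
  have e : 1 - (r - 1) * (r + 2) / (2 * r ^+ 2) * 1 ^+ 2 = (r ^+ 2 - r + 2) / (2 * r ^+ 2).
    by field; rewrite gt_eqF.
  rewrite /majorant2 e; field.
  by rewrite !gt_eqF.
rewrite mulrAC ler_pdivlMr//.
have t0 : 0 <= t by nra.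
have h2 : 0 <= (r - 1) * t by rewrite mulr_ge0// subr_ge0 ltW.
nra.
Qed.

Lemma lyap_cayley A (r : R) : 1 < r -> lyap P r%:E A ->
  cayley_le P A (majorant ((r - 1) / (2 * r)) ((r - 1) * (r + 2) / (2 * r ^+ 2)) 1).
Proof.
move=> r1 /lyapP h x; have r0 : 0 < r by apply: lt_trans r1.
have [->|x0] := eqVneq x 0; first by rewrite mulmx0 subr0 addr0 vnorm0 mulr0.
have := h x x0; rewrite fine_inve_fin ?gt_eqF// => hx.
have S0 : 0 <= rdot P (A *m x) (A *m x) + rdot P x x by rewrite addr_ge0 ?rdot_ge0.
have := rate_bound r1 S0 hx.
set S := rdot P (A *m x) (A *m x) + _; set t := rdot P x (A *m x); set m := majorant2 _ _ _.
move=> key.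
have e1 : vnorm P (A *m x + x) ^+ 2 = S + t *+ 2.
  by rewrite (vnorm_sqrD hP) -/t /S addrAC.
have e2 : vnorm P (A *m x - x) ^+ 2 = S - t *+ 2.
  by rewrite (vnorm_sqrB hP) -/t /S addrAC.
rewrite -e1 -e2 in key.
have v1 := vnorm_ge0 P (A *m x + x); have v2 := vnorm_ge0 P (A *m x - x).
rewrite /majorant -/m -(ger0_norm v1) -[`|_|]sqrtr_sqr -(ger0_norm v2) -[X in X <= _]sqrtr_sqr.
rewrite mulrC -sqrtrM ?sqr_ge0// ler_wsqrtr//.
by rewrite mulrC.
Qed.

Lemma lyap_princ_pow A (eta : \bar R) (g : R) : (1%:E < eta)%E -> lyap P eta A ->
  1 <= g < pow_bound eta -> lyap P +oo%E (princ_pow A g).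
Proof.
case: eta => [r| |] heta hA; rewrite /pow_bound => /andP[g1 hg].
2: by exfalso; move: (le_lt_trans g1 hg); rewrite ltxx.
2: by exfalso; move: heta; rewrite ltNge leNye.
rewrite lte_fin in heta; have r1 : 1 < r := heta.
have r0 : 0 < r by apply: lt_trans r1.
(* The constant a makes a / (1 - a) equal to (r - 1)/(r + 1). Then b is fixed by a + b = (r^2 - 1) /
   r^2, so that the majorant is below 1 exactly up to [pow_bound]; this leaves b - a = (r - 1) / r^2
   > 0. *)
pose a := (r - 1) / (2 * r); pose b := (r - 1) * (r + 2) / (2 * r ^+ 2).
have a0 : 0 < a by rewrite divr_gt0 ?subr_gt0// mulr_gt0.
have ab : a < b.
  have -> : b = a + (r - 1) / r ^+ 2 by rewrite /a /b; field; rewrite gt_eqF.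
  by rewrite ltrDl divr_gt0 ?subr_gt0// exprn_gt0.
have b0 : 0 < b by apply: lt_trans ab.
have q : 0 < r ^+ 2 - 1 by rewrite subr_gt0 expr_gt1// ltW.
have hG : (a + b) * g ^+ 2 < 1.
  have -> : a + b = (r ^+ 2 - 1) / r ^+ 2 by rewrite /a /b; field; rewrite gt_eqF.
  rewrite mulrAC ltr_pdivrMr ?exprn_gt0// mul1r -[r ^+ 2 - 1]sqr_sqrtr ?ltW//.
  rewrite -exprMn ltr_pXn2r// ?nnegrE ?mulr_ge0 ?sqrtr_ge0 ?(ltW r0)//.
    by rewrite mulrC -ltr_pdivlMr// sqrtr_gt0.
  exact: le_trans g1.
have h1 : (a + b) * 1 ^+ 2 < 1.
  by apply: le_lt_trans hG; rewrite ler_pM2l ?addr_gt0// expr1n expr_ge1// (le_trans _ g1).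
have [_ _ k0 k1] := majorant_range a0 b0 h1.
have kk : 0 <= majorant a b 1 < 1 by rewrite k0.
have hc := lyap_cayley r1 hA.
have [L0 [L0A L0s]] := log_exists hP kk hc.
have : exists M, [set expmx (g%:C *: L) | L in [set L | is_princ_log A L]] M.
  exists (expmx (g%:C *: L0)); exists L0 => //; split => // l /eigenvalue_colP [v v0 hv].
  by have := L0s l v v0 hv; rewrite ltr_norml.
(* L0 shows that the set is nonempty, so the default 0 is not taken; from here on L is the logarithm
   behind the chosen value. *)
rewrite /princ_pow => /(xgetPex 0); set M := xget _ _ => -[L [LA Ls] LM].
have hs : in_strip L.
  move=> l v v0 hv; rewrite ltr_norml; apply: Ls; apply/eigenvalue_colP.
  by exists v.
have gg : 1 <= g <= g by rewrite g1 lexx.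
rewrite -LA in hc.
have := cayley_continuation hP a0 ab hG gg hs hc; rewrite LM => hM.
have [_ _ k0' k1'] := majorant_range a0 b0 hG.
apply/lyap_ooP => x x0; exact: (rdot_of_cayley hP k1' (hM x) x0).
Qed.

End LyapunovSets.

(** * Spectral radius and Hermitian pencils, for part (i) *)

Lemma seq_lt_bound (R : realDomainType) (t : seq R) (r : R) :
  (forall x, x \in t -> x < r) -> exists2 m, m < r & forall x, x \in t -> x <= m.
Proof.
elim: t => [|y t IH] h; first by exists (r - 1); rewrite ?gtrBl.
have [|m mr hm] := IH; first by move=> x xt; apply: h; rewrite in_cons xt orbT.
exists (Num.max y m); first by rewrite gt_max mr h// mem_head.
by move=> x; rewrite in_cons le_max => /orP[/eqP->|/hm ->]; rewrite ?lexx ?orbT.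
Qed.

Lemma sub_scale_entry (K : pzRingType) m p (A B : 'M[K]_(m, p)) c i j :
  (A - c *: B) i j = A i j - c * B i j.
Proof. by rewrite !mxE. Qed.

Section SpectralRadius.
Variable R : realType.

Lemma eigenvalue_seq n (M : 'M[R[i]]_n.+1) :
  exists s : seq R[i], forall l, eigenvalue M l -> l \in s.
Proof.
have [s hs] := closed_field_poly_normal (char_poly M).
exists s => l; rewrite eigenvalue_root_char hs (monicP (char_poly_monic M)) scale1r.
by rewrite root_prod_XsubC.
Qed.

Lemma spectral_radius_lt n (M : 'M[R[i]]_n.+1) (r : R) : 0 < r ->
  (forall l, eigenvalue M l -> Normc.normc l < r) -> spectral_radius M < r.
Proof.
move=> r0 h; rewrite /spectral_radius; set S := [set _ | _ in _].
(* The supremum of the empty set is 0 by convention, below r by [r0]. *)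
have [->|/set0P S0] := eqVneq S set0; first by rewrite sup0.
have [s hs] := eigenvalue_seq M.
(* Finiteness of the spectrum gives a common bound m < r, so the supremum stays strictly below r. *)
have [|m mr hm] := @seq_lt_bound R [seq Normc.normc l | l <- s & eigenvalue M l] r.
  by move=> x /mapP [l]; rewrite mem_filter => /andP[/h hl _] ->.
apply: le_lt_trans mr; apply: ge_sup => // _ [l hl <-].
by apply/hm/map_f; rewrite mem_filter; apply/andP; split; [exact: hl | exact: hs].
Qed.

Lemma normc_le_spectral_radius n (M : 'M[R[i]]_n.+1) l :
  eigenvalue M l -> Normc.normc l <= spectral_radius M.
Proof.
move=> hl; apply: ub_le_sup; last by exists l.
have [s hs] := eigenvalue_seq M.
exists (\sum_(x <- s) Normc.normc x) => _ [k /hs ks <-].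
rewrite (big_rem k)//= lerDl sumr_ge0// => ? _; exact: normc_ge0.
Qed.

(** From the spectral theorem H = U^* d U take S = sqrt(d) U, a factor meant for a congruence. *)
Lemma posdef_sqrt n (H : 'M[R[i]]_n.+1) : posdef H ->
  exists2 S : 'M[R[i]]_n.+1, S \in unitmx & H = S^t* *m S.
Proof.
move=> [hH pH]; have nH : H \is normalmx.
  by apply/normalmxP; rewrite (hermsymmxP _ hH).
have := orthomx_spectralP nH.
set U := spectralmx H; set d := spectral_diag H => HE.
have uU : U \is unitarymx := spectral_unitarymx H.
have UU : U *m U^t* = 1%:M by apply/unitarymxP.
have U'U : U^t* *m U = 1%:M := mulmx1C UU.
rewrite (invmx_unitary uU) in HE.
have d0 i : 0 < d 0 i.
  pose z : 'cV[R[i]]_n.+1 := delta_mx i 0; pose x := U^t* *m z.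
  have x0 : x != 0.
    apply/eqP => /(congr1 (mulmx U)); rewrite /x mulmxA UU mul1mx mulmx0.
    by move/matrixP/(_ i 0); rewrite !mxE !eqxx => /eqP; rewrite oner_eq0.
  have := pH x x0; rewrite {1}HE /x trC_mul trmxCK.
  have -> : z^t* *m U *m (U^t* *m diag_mx d *m U) *m (U^t* *m z) = z^t* *m diag_mx d *m z.
    by rewrite !mulmxA !(mulmxtVK _ uU).
  have -> : z^t* = delta_mx 0 i.
    by apply/matrixP => a b; rewrite !mxE andbC; case: (_ && _); rewrite ?rmorph1 ?rmorph0.
  by rewrite -rowE -colE !mxE eqxx mulr1n.
pose e := \row_i sqrtC (d 0 i).
exists (diag_mx e *m U).
  rewrite unitmx_mul (mulmx1_unit UU).1 andbT unitmxE det_diag unitfE.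
  by apply/prodf_neq0 => i _; rewrite mxE sqrtC_eq0 gt_eqF.
have eC : (diag_mx e)^t* = diag_mx e.
  apply/matrixP => a b; rewrite !mxE eq_sym; case: eqP => [->|_]; last by rewrite rmorph0.
  rewrite !mulr1n; apply/CrealP; rewrite ger0_real// sqrtC_ge0.
  exact: ltW.
have ee : diag_mx e *m diag_mx e = diag_mx d.
  by rewrite mulmx_diag; congr diag_mx; apply/rowP => i; rewrite !mxE -expr2 sqrtCK.
by rewrite HE trC_mul eC -ee !mulmxA.
Qed.

(** A left eigenvector v of N H^-1 satisfies v N = l v H, so l is the quotient of the forms of N and
    H at v^*; it is positive, and below r because H - N / r is positive definite. *)
Lemma spectral_radius_pencil_lt n (H N : 'M[R[i]]_n.+1) (r : R) : 0 < r ->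
  posdef H -> posdef N -> posdef (H - r^-1%:C *: N) ->
  spectral_radius (N *m invmx H) < r.
Proof.
move=> r0 pH pN pD; apply: spectral_radius_lt => // l /eigenvalueP [v hv v0].
have uH := posdef_unitmx pH.
have vN : v *m N = l *: (v *m H).
  by rewrite scalemxAl -hv mulmxA mulmxKV.
pose y := v^t*; have yv : y^t* = v by rewrite trmxCK.
have y0 : y != 0.
  by apply/eqP => h; move/eqP: v0; apply; rewrite -yv h; apply/matrixP => a b; rewrite !mxE rmorph0.
have := pD.2 y y0; have := pN.2 y y0; have := pH.2 y y0.
rewrite mulmxBr mulmxBl -scalemxAr -scalemxAl yv sub_scale_entry.
set h := (v *m H *m y) 0 0; set m := (v *m N *m y) 0 0 => h0 m0 d0.
have hm : m = l * h by rewrite /m vN -scalemxAl mxE.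
clearbody h m.
have hE : h = (complex.Re h)%:C by rewrite RRe_real// gtr0_real.
have mE : m = (complex.Re m)%:C by rewrite RRe_real// gtr0_real.
rewrite hE ltcR in h0; rewrite mE ltcR in m0.
rewrite hE mE -rmorphM -rmorphB /= ltcR subr_gt0 ltr_pdivrMl// in d0.
have : Normc.normc m = Normc.normc l * Normc.normc h by rewrite hm Normc.normcM.
rewrite hE mE !normcR (gtr0_norm h0) (gtr0_norm m0) => hh.
by rewrite -(ltr_pM2r h0) -hh.
Qed.

Lemma diag_form n (f : 'rV[R[i]]_n.+1) (y : 'cV[R[i]]_n.+1) :
  complex.Re ((y^t* *m diag_mx f *m y) 0 0) =
  \sum_j Normc.normc (y j 0) ^+ 2 * complex.Re (f 0 j).
Proof.
rewrite mxE Re_sum; apply: eq_bigr => j _.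
by rewrite mul_mx_diag !mxE mulrAC mul_conj_normc ReZ.
Qed.

(** Simultaneous diagonalization by congruence: for H = S^* S and V unitary diagonalizing T, the
    matrix W = V S turns H into 1 and N into diag e, so H - N / r becomes the diagonal matrix of the
    1 - e_j / r. *)
Lemma posdef_pencil n (H N : 'M[R[i]]_n.+1) (r : R) : 0 < r ->
  posdef H -> N \is hermsymmx -> spectral_radius (N *m invmx H) < r ->
  posdef (H - r^-1%:C *: N).
Proof.
move=> r0 pH hN hr; have [S uS HE] := posdef_sqrt pH.
have uS' : S^t* \in unitmx by rewrite map_unitmx unitmx_tr.
pose T := invmx (S^t*) *m N *m invmx S.
have NE : N = S^t* *m T *m S by rewrite /T !mulmxA mulmxV// mul1mx mulmxKV.
have hT : T \is hermsymmx.
  apply/hermsymmxP; apply: (can_inj (mulKmx uS')).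
  apply: (can_inj (mulmxK uS)); rewrite -NE.
  have := hermsymmxP _ hN; rewrite {1}NE !trC_mul trmxCK mulmxA.
  by [].
clearbody T; have nT : T \is normalmx by apply/normalmxP; rewrite (hermsymmxP _ hT).
have := orthomx_spectralP nT.
have := hermitian_spectral_diag_real hT.
set V := spectralmx T; set e := spectral_diag T => eR TE.
have uV : V \is unitarymx := spectral_unitarymx T.
have VV : V *m V^t* = 1%:M by apply/unitarymxP.
have V'V : V^t* *m V = 1%:M := mulmx1C VV.
rewrite (invmx_unitary uV) in TE.
have VT : V *m T = diag_mx e *m V by rewrite TE !mulmxA VV mul1mx.
have e_lt j : complex.Re (e 0 j) < r.
  apply: le_lt_trans hr; apply: le_trans (ler_Re_normc _) _.
  apply: normc_le_spectral_radius; apply/eigenvalueP.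
  (* A row of V is a left eigenvector of T; undoing the congruence makes it a left eigenvector of N
     H^-1 for the same e_j. *)
  exists (row j V *m invmx (S^t*)).
    have vH : row j V *m invmx (S^t*) *m H = row j V *m S.
      by rewrite HE mulmxA mulmxKV.
    have vN : row j V *m invmx (S^t*) *m N = e 0 j *: (row j V *m S).
      have -> : row j V *m invmx (S^t*) *m N = row j V *m T *m S.
        by rewrite NE !mulmxA mulmxKV.
      have -> : row j V *m T = e 0 j *: row j V; last by rewrite -scalemxAl.
      by rewrite -row_mul VT; apply/rowP => k; rewrite mul_diag_mx !mxE.
    by rewrite mulmxA vN -vH -scalemxAl mulmxK// posdef_unitmx.
  apply/eqP => /(congr1 (mulmx^~ (S^t* *m V^t*))).
  rewrite mul0mx mulmxA mulmxKV// -row_mul VV row1 => /rowP /(_ j).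
  by rewrite !mxE !eqxx => /eqP; rewrite oner_eq0.
pose W := V *m S.
have uW : W \in unitmx by rewrite unitmx_mul (mulmx1_unit VV).1.
pose f := \row_j (1 - r^-1%:C * e 0 j).
have DE : H - r^-1%:C *: N = W^t* *m diag_mx f *m W.
  have -> : diag_mx f = 1%:M - r^-1%:C *: diag_mx e.
    apply/matrixP => a b; rewrite !mxE; case: (a == b); rewrite ?mulr1n//.
    by rewrite mulr0n mulr0 subrr.
  rewrite mulmxBr mulmxBl -scalemxAr -scalemxAl mulmx1 /W trC_mul.
  rewrite {1}HE {1}NE {1}TE !mulmxA; congr (_ - _).
  by rewrite -[_ *m V^t* *m V]mulmxA V'V mulmx1.
clearbody W; apply: posdef_Re.
  rewrite DE; apply/hermsymmxP; rewrite !trC_mul trmxCK mulmxA; congr (_ *m _ *m _).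
  apply/matrixP => a b; rewrite !mxE eq_sym; case: eqP => [->|_]; last by rewrite rmorph0.
  rewrite !mulr1n rmorphB rmorph1 rmorphM /=.
  congr (1 - _ * _); first by rewrite conjCE conjc_real.
  by apply/CrealP; exact: (mxOverP eR).
move=> x x0; rewrite DE.
have -> : x^t* *m (W^t* *m diag_mx f *m W) *m x = (W *m x)^t* *m diag_mx f *m (W *m x).
  by rewrite trC_mul !mulmxA.
rewrite diag_form.
have y0 : W *m x != 0.
  by apply/eqP => /(congr1 (mulmx (invmx W))); rewrite mulKmx// mulmx0 => /eqP; apply/negP.
have [j yj] : exists j, (W *m x) j 0 != 0.
  by have /matrix0Pn [j [k]] := y0; rewrite (ord1 k) => hj; exists j.
have fj k : 0 < complex.Re (f 0 k).
  by rewrite mxE ReB ReZ /= subr_gt0 ltr_pdivrMl// mulr1.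
rewrite (bigD1 j)//= ltr_pwDl//.
  rewrite mulr_gt0// exprn_gt0// lt0r normc_ge0 andbT.
  by apply/eqP => /Normc.eq0_normc /eqP; apply/negP.
by apply: sumr_ge0 => k _; rewrite mulr_ge0 ?sqr_ge0// ltW.
Qed.

End SpectralRadius.

(** * Part (i) and the theorem *)

Section SpectralCharacterization.
Variables (R : realType) (n : nat) (P : 'M[R[i]]_n.+1).
Hypothesis hP : posdef P.
Implicit Types (A : 'M[R[i]]_n.+1).

Lemma lyap_subset_oo A (eta : \bar R) : (0 <= fine (inve eta)) ->
  lyap P eta A -> lyap P +oo%E A.
Proof.
move=> c0 /(lyapP hP) h; apply/(lyap_ooP hP) => x x0.
have := h x x0; have := mulr_ge0 c0 (addr_ge0 (rdot_ge0 hP (A *m x)) (rdot_ge0 hP x)).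
by move=> /le_lt_trans /[apply]; rewrite pmulr_rgt0.
Qed.

Lemma lyap_oo_posdef A : lyap P +oo%E A -> posdef (A^t* *m P + P *m A).
Proof.
by rewrite /lyap /loewner_gt /= scale0r subr0 addrC.
Qed.

Lemma posdef_congruence_add A : posdef (A^t* *m P *m A + P).
Proof.
have hh := hermsymmxP _ hP.1; apply: posdef_Re.
  by apply/hermsymmxP; rewrite trC_add !trC_mul trmxCK hh mulmxA.
move=> x x0; rewrite mulmxDr mulmxDl mxE ReD.
have -> : complex.Re ((x^t* *m (A^t* *m P *m A) *m x) 0 0) = rdot P (A *m x) (A *m x).
  by rewrite /rdot trC_mul !mulmxA.
exact: (ltr_wpDl (rdot_ge0 hP (A *m x)) (rdot_gt0 hP x0)).
Qed.

Lemma lyap_spectral_radius (r : R) A : 0 < r ->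
  lyap P r%:E A <-> lyap P +oo%E A /\
    spectral_radius ((A^t* *m P *m A + P) *m invmx (A^t* *m P + P *m A)) < r.
Proof.
move=> r0; have rE := fine_inve_fin (lt0r_neq0 r0).
have lE : lyap P r%:E A <->
    posdef (A^t* *m P + P *m A - r^-1%:C *: (A^t* *m P *m A + P)).
  by rewrite /lyap /loewner_gt /= rE [P *m A + _]addrC.
split=> [hA|[hA hr]].
  have hoo : lyap P +oo%E A.
    by apply: lyap_subset_oo hA; rewrite rE invr_ge0 ltW.
  split; first exact: hoo.
  exact: (spectral_radius_pencil_lt r0 (lyap_oo_posdef hoo)
    (posdef_congruence_add A) (lE.1 hA)).
apply/lE; exact: (posdef_pencil r0 (lyap_oo_posdef hA) (posdef_congruence_add A).1 hr).
Qed.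

End SpectralCharacterization.

Theorem corollary5p4 (R : realType) (n : nat) (P : 'M[R[i]]_n.+1)
    (eta : \bar R) (hP : posdef P) (heta : (1%:E < eta)%E) :
  [/\ lyap P eta =
      [set A | lyap P +oo%E A /\
         (eta > (spectral_radius ((A^t* *m P *m A + P) *m
                                    invmx (A^t* *m P + P *m A)))%:E)%E],
      forall A, lyap P eta A -> spec A `<=` Dinv eta
    & forall A, lyap P eta A ->
        forall g : R, 1 <= g < pow_bound eta -> lyap P +oo%E (princ_pow A g)].
Proof.
split; last 2 first.
- by move=> A; exact: lyap_spec.
- by move=> A hA g; exact: lyap_princ_pow.
apply/seteqP; case: eta heta => [r| |] h1; last by move: h1; rewrite ltNge leNye.
  have r0 : 0 < r by rewrite lte_fin in h1; apply: lt_trans h1.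
  by split=> A; rewrite /= lte_fin => /(lyap_spectral_radius hP A r0).
by split=> A /=; [move=> hA; split; rewrite ?ltry | case].
Qed.
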